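(* Let $R:\mathbb{R}^+\to\mathbb{R}^+$ be a regularly increasing function with index $0$. For $\varphi:\mathbb{R}^+\to\mathbb{R}^+$ let \[L(\varphi)=\Big\{x\in(0,1)\setminus\mathbb{Q}:\ \lim_{n\to\infty}\frac{L_n(x)}{\varphi(n)}=1\Big\},\qquad L_n(x)=\max_{1\le i\le n}\{a_i(x)a_{i+1}(x)\}.\] Then $\dim_{\mathrm H}L(\varphi)=1$ if $\log\varphi(n)=\sqrt{n}/R(n)$ for all $n$, and $\dim_{\mathrm H}L(\varphi)=1/2$ if $\log\varphi(n)=\sqrt{n}\,R(n)$ for all $n$.
   Context: Every irrational $x\in(0,1)$ has a unique infinite continued fraction expansion $x=[a_1(x),a_2(x),\ldots]=\cfrac{1}{a_1(x)+\cfrac{1}{a_2(x)+\ddots}}$ with positive integer partial quotients $a_n(x)$. A function $f$ is called regularly increasing with index $\rho\in[0,\infty]$ if for some constant $c>0$, $f\in C^1([c,\infty))$, $f(x)>0$, $\lim_{x\to\infty}f(x)=\infty$, $f'(x)>0$, and $\lim_{x\to\infty}\frac{xf'(x)}{f(x)}=\rho$. $\dim_{\mathrm H}$ denotes Hausdorff dimension. *)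

(* Defs.v *)
From HB Require Import structures.
From mathcomp Require Import all_boot all_order all_algebra.
From mathcomp Require Import all_classical all_reals all_analysis.

Set Implicit Arguments.
Unset Strict Implicit.
Unset Printing Implicit Defensive.

Import Order.TTheory GRing.Theory Num.Theory.
Import numFieldNormedType.Exports.

Local Open Scope classical_set_scope.
Local Open Scope ring_scope.

Section continued_fractions.
Context {R : realType}.

Fixpoint finite_cf (s : seq nat) : R :=
  if s is b :: s' then (b%:R + finite_cf s')^-1 else 0.

(* [b] is indexed from 0: [b n] is the partial quotient number [n.+1]. *)
Definition cf_expansion (b : nat -> nat) (x : R) : Prop :=
  (forall n, (0 < b n)%N) /\ finite_cf (mkseq b n) @[n --> \oo] --> x.

(* For irrational [x] in (0, 1) the expansion exists and is unique, so that
   [get] selects it; elsewhere the value is irrelevant.  Indexed from 1;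
   the value at [n = 0] is not used. *)
Definition partial_quotient (n : nat) (x : R) : nat :=
  get [set b : nat -> nat | cf_expansion b x] n.-1.

Definition max_product (n : nat) (x : R) : nat :=
  \max_(1 <= i < n.+1) (partial_quotient i x * partial_quotient i.+1 x)%N.

Definition L_set (phi : R -> R) : set R :=
  [set x : R | [/\ 0 < x < 1, irrational x &
    (max_product n x)%:R / phi n%:R @[n --> \oo] --> (1 : R)]].

End continued_fractions.

Section regularly_increasing.
Context {R : realType}.

(* [g] is the derivative of [f] on [c, +oo), one-sided at the endpoint [c]. *)
Definition C1_with_derivative (c : R) (f g : R -> R) : Prop :=
  (forall x : R, c <= x ->
     (f y - f x) / (y - x) @[y --> within `[c, +oo[ x^'] --> g x) /\
  {within `[c, +oo[, continuous g}.

Definition regularly_increasing (f : R -> R) (rho : \bar R) : Prop :=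
  exists2 c : R, 0 < c &
    exists g : R -> R, [/\ C1_with_derivative c f g,
      forall x : R, c <= x -> 0 < f x,
      f x @[x --> +oo] --> +oo,
      forall x : R, c <= x -> 0 < g x &
      (x * g x / f x)%:E @[x --> +oo] --> rho].

End regularly_increasing.

Section hausdorff_dimension.
Context {R : realType}.
Local Open Scope ereal_scope.

Definition diameter (U : set R) : \bar R :=
  ereal_sup ([set 0] `|` [set `|x - y|%:E | x in U & y in U]).

(* The empty set has weight 0 also for [s = 0], whereas [0 `^ 0 = 1], so that
   the Hausdorff measure of dimension 0 is the counting measure. *)
Definition hausdorff_weight (s : R) (U : set R) : \bar R :=
  if U == set0 then 0 else diameter U `^ s.

Definition hausdorff_premeasure (s delta : R) (A : set R) : \bar R :=
  ereal_inf [set \sum_(0 <= i <oo) hausdorff_weight s (U i) |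
    U in [set U : nat -> set R |
      (forall i, diameter (U i) <= delta%:E) /\ A `<=` \bigcup_i U i]].

Definition hausdorff_measure (s : R) (A : set R) : \bar R :=
  ereal_sup [set hausdorff_premeasure s delta A |
    delta in [set delta : R | (0 < delta)%R]].

Definition hausdorff_dim (A : set R) : \bar R :=
  ereal_inf [set s%:E |
    s in [set s : R | (0 <= s)%R /\ hausdorff_measure s A = 0]].

End hausdorff_dimension.

(* Main.v *)
(** Upper bound 1/2: when log phi = sqrt n * R n, the maximum of the products
    a_i a_(i+1) has to jump in every window of length p inside (p^2, 2 p^2], each
    jump being of size about phi (p^2).  Hence log (a_1 ... a_n) / n is unbounded
    along the expansion of every point of the set.  Covering by the cylinders of
    words w with a_1 ... a_n >= E^n and comparing |cylinder|^s with
    prod a_i^(-2 s) gives Hausdorff measure 0 for every s > 1/2.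

    Lower bounds: for digits restricted to intervals [lo n, hi n], split the unit
    mass along the tree of words, proportionally to |cylinder|^s.  Choosing digits
    greedily gives a map G from [0, 1) to the set with
    |y - z| <= C |G y - G z|^s, so the set has positive s-dimensional measure by
    comparison with Lebesgue measure.
    - If log phi = sqrt n * R n, take a_n close to sqrt (phi n) for all n: about
      sqrt (phi n) / n choices, which beats |cylinder|^s for s < 1/2.
    - If log phi = sqrt n / R n, put the digit floor (phi (k^2)) at the positions
      k^2, with neighbours 1, and let the other digits range over 1, ..., M.  For
      s < 1 and M large, sum_(c <= M) |I(w c)|^s >= lam |I(w)|^s with lam > 1: the
      gain lam^(2 k) of a block exceeds the cost, of order phi (k^2)^2 =
      exp (2 k / R (k^2)), because R tends to infinity. *)

Require Import Defs.
From HB Require Import structures.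
From mathcomp Require Import all_boot all_order all_algebra.
From mathcomp Require Import all_classical all_reals all_analysis.
From mathcomp Require Import ring lra zify.

Set Implicit Arguments.
Unset Strict Implicit.
Unset Printing Implicit Defensive.

Import Order.TTheory GRing.Theory Num.Theory.
Import numFieldNormedType.Exports.

Local Open Scope classical_set_scope.
Local Open Scope ring_scope.

(** * Continued fractions *)

(** Why sqrt n is the threshold: sqrt (n + p) - sqrt n is of order 1 when p is of order sqrt n. Over
    such a window, exp (sqrt n * R n) grows by a large factor, so a new record product is forced in
    each window; exp (sqrt n / R n) is asymptotically constant there, so one large product per gap
    between consecutive squares suffices. Either way about sqrt n large products occur before n,
    with total logarithm of order sqrt n * log (phi n), that is n * R n or n / R n. This is weighed
    against the linear budget of n digits: R tending to infinity makes the first too expensive and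
    the second negligible.

    Index 0 enters through the monotonicity of R^4 / x for large x, which controls increments
    without asymptotic expansions.

    The obstacle in the lower bounds is that points of different cylinders can be arbitrarily close:
    [.., b, 1, N, ..] and [.., b+1, N, ..] with N large. The digit ranges are therefore chosen so
    that after a free digit the next one is always at least 2, or always bounded. *)

Section continued_fraction_basics.
Context {K : realType}.
Implicit Types (s : seq nat) (b d : nat -> nat) (t u x y : K).

(** [t] stands for the whole tail after the word [s]; as [t] runs over [0, 1], the values fill the
    closed cylinder of [s]. *)
Definition cf s t : K := foldr (fun (c : nat) z => (c%:R + z)^-1) t s.

(* [q + t * q'] with [q], [q'] the last two continuants of [s]. *)
Fixpoint den s t : K := if s is c :: s' then (c%:R + cf s' t) * den s' t else 1.

Lemma finite_cfE s : finite_cf s = cf s 0.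
Proof. by elim: s => //= c s ->. Qed.

Lemma cf_cat s1 s2 t : cf (s1 ++ s2) t = cf s1 (cf s2 t).
Proof. by rewrite /cf foldr_cat. Qed.

Lemma cf_rcons s c t : cf (rcons s c) t = cf s (c%:R + t)^-1.
Proof. by rewrite -cats1 cf_cat. Qed.

Lemma den_rcons s c t : den (rcons s c) t = den s (c%:R + t)^-1 * (c%:R + t).
Proof.
elim: s => [|a s IH] /=; first by rewrite mulr1 mul1r.
by rewrite IH cf_rcons mulrA.
Qed.

Notation all_pos := (all (leq 1)).

Lemma natr_ge1 (c : nat) : (0 < c)%N -> 1 <= c%:R :> K.
Proof. by move=> c0; rewrite ler1n. Qed.

Lemma cf_ge0 s t : 0 <= t -> 0 <= cf s t.
Proof. by move=> t0; elim: s => //= c s IH; rewrite invr_ge0 addr_ge0. Qed.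

Lemma cf_le1 s t : all_pos s -> 0 <= t <= 1 -> cf s t <= 1.
Proof.
case: s => [|c s] /=; first by move=> _ /andP[].
case/andP=> c0 _ /andP[t0 _]; rewrite invf_le1; last first.
  by rewrite ltr_pwDl ?ltr0n // cf_ge0.
by rewrite -[leLHS]addr0 lerD ?cf_ge0 // natr_ge1.
Qed.

Lemma den_ge_prod s t : 0 <= t -> all_pos s ->
  \prod_(c <- s) c%:R <= den s t.
Proof.
move=> t0; elim: s => [|c s IH] /=; first by rewrite big_nil.
case/andP=> c0 /IH h; rewrite big_cons ler_pM ?prodr_ge0 //.
by rewrite lerDl cf_ge0.
Qed.

Lemma den_gt0 s t : 0 <= t -> all_pos s -> 0 < den s t.
Proof.
move=> t0; elim: s => [|c s IH] //= /andP[c0 /IH h].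
by rewrite mulr_gt0 // ltr_pwDl ?ltr0n ?cf_ge0.
Qed.

(** Appending a digit c sends the continuants (q, q') to (c q + q', q). Affinity in [t] reduces all
    later estimates to the two numbers [den s 0] = q and [den s 1] = q + q'. *)
Lemma den_affine s t : all_pos s -> 0 <= t ->
  den s t = den s 0 + t * (den s 1 - den s 0).
Proof.
elim/last_ind: s t => [|s c IH] t /=; first by move=> _ _; rewrite subrr mulr0 addr0.
rewrite all_rcons => /andP[c0 sp] t0.
have c1 := natr_ge1 c0.
have p0 : 0 <= (c%:R + t)^-1 by rewrite invr_ge0 addr_ge0.
rewrite !den_rcons addr0 (IH _ sp p0) (IH (c%:R)^-1) ?invr_ge0 //.
rewrite (IH (c%:R + 1)^-1) ?invr_ge0 ?addr_ge0 //.
by field; rewrite !gt_eqF; lra.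
Qed.

Lemma den_le s : all_pos s -> den s 0 <= den s 1 <= 2 * den s 0.
Proof.
elim/last_ind: s => [|s c IH] /=; first by lra.
rewrite all_rcons => /andP[c0 sp].
have c1 := natr_ge1 c0; have := IH sp => {IH} /andP[h1 h2].
rewrite !den_rcons addr0 (@den_affine _ (c%:R)^-1) ?invr_ge0 //.
rewrite (@den_affine _ (c%:R + 1)^-1) ?invr_ge0 ?addr_ge0 //.
have -> : (den s 0 + c%:R^-1 * (den s 1 - den s 0)) * c%:R =
  c%:R * den s 0 + (den s 1 - den s 0) by field; rewrite gt_eqF; lra.
have -> : (den s 0 + (c%:R + 1)^-1 * (den s 1 - den s 0)) * (c%:R + 1) =
  (c%:R + 1) * den s 0 + (den s 1 - den s 0) by field; rewrite gt_eqF; lra.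
have := den_gt0 (lexx 0) sp; nra.
Qed.

Lemma den_rcons0 s c : all_pos s -> (0 < c)%N ->
  den (rcons s c) 0 = (c%:R - 1) * den s 0 + den s 1.
Proof.
move=> sp c0; have c1 := natr_ge1 c0.
rewrite den_rcons addr0 den_affine ?invr_ge0 //.
by field; rewrite gt_eqF; lra.
Qed.

Lemma den_rcons1 s c : all_pos s -> (0 < c)%N ->
  den (rcons s c) 1 = c%:R * den s 0 + den s 1.
Proof.
move=> sp c0; have c1 := natr_ge1 c0.
rewrite den_rcons den_affine ?invr_ge0 ?addr_ge0 //.
by field; rewrite gt_eqF; lra.
Qed.

(** Each level z -> 1 / (c + z) divides distances by the two denominators it meets, and [den]
    collects exactly these factors. *)
Lemma cf_dist s t u : all_pos s -> 0 <= t -> 0 <= u ->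
  `|cf s t - cf s u| = `|t - u| / (den s t * den s u).
Proof.
move=> sp t0 u0; elim: s sp => [|c s IH] /=; first by rewrite mulr1 divr1.
case/andP=> c0 sp.
have dt : 0 < c%:R + cf s t by rewrite ltr_pwDl ?ltr0n ?cf_ge0.
have du : 0 < c%:R + cf s u by rewrite ltr_pwDl ?ltr0n ?cf_ge0.
have -> : (c%:R + cf s t)^-1 - (c%:R + cf s u)^-1 =
   - ((cf s t - cf s u) / ((c%:R + cf s t) * (c%:R + cf s u))).
  by field; rewrite !gt_eqF.
rewrite normrN normrM IH // (@ger0_norm _ (_^-1)) ?invr_ge0 ?mulr_ge0 ?ltW //.
by field; rewrite !gt_eqF ?den_gt0.
Qed.

(** Linear growth is enough to make cylinders shrink to points. The companion bound at t = 1 carries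
    the induction. *)
Lemma den_ge_size s : all_pos s -> (size s)%:R <= den s 0.
Proof.
move=> sp; suff : (size s)%:R <= den s 0 /\ (size s)%:R + 1 <= den s 1 by case.
elim/last_ind: s sp => [|s c IH]; first by rewrite /=; lra.
rewrite all_rcons => /andP[c0 sp]; rewrite size_rcons -natr1.
rewrite den_rcons0 // den_rcons1 //.
have c1 := natr_ge1 c0; have [] := IH sp; have := den_gt0 (lexx 0) sp.
case: s sp {IH} => [|a s] sp /=; first by nra.
have : 1 <= (size s).+1%:R :> K by rewrite ler1n.
by move=> *; nra.
Qed.

Lemma den_le_at1 s t : all_pos s -> 0 <= t <= 1 -> den s 0 <= den s t <= den s 1.
Proof.
move=> sp /andP[t0 t1]; rewrite (den_affine sp t0).
by have /andP[h _] := den_le sp; apply/andP; split; nra.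
Qed.

Lemma den_ge1 s t : all_pos s -> 0 <= t -> 1 <= den s t.
Proof.
move=> sp t0; apply: le_trans (den_ge_prod t0 sp).
elim: s sp => [|c s IH] /=; first by rewrite big_nil.
by case/andP=> c0 /IH h; rewrite big_cons -[leLHS]mulr1 ler_pM ?natr_ge1.
Qed.

Lemma dist_unit_le1 x y : 0 <= x <= 1 -> 0 <= y <= 1 -> `|x - y| <= 1.
Proof. by move=> /andP[? ?] /andP[? ?]; rewrite ler_norml; apply/andP; split; lra. Qed.

Lemma cf_dist_size s t u : all_pos s -> 0 <= t <= 1 -> 0 <= u <= 1 ->
  `|cf s t - cf s u| * (size s)%:R <= 1.
Proof.
move=> sp t01 u01; have /andP[t0 t1] := t01; have /andP[u0 u1] := u01.
rewrite cf_dist // mulrAC ler_pdivrMr ?mulr_gt0 ?den_gt0 // mul1r.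
have /andP[h _] := den_le_at1 sp t01.
have h2 := den_ge_size sp; have h3 := den_ge1 sp u0.
have h4 := dist_unit_le1 t01 u01; apply: le_trans (_ : (size s)%:R <= _).
  by rewrite -[leRHS]mul1r ler_wpM2r.
rewrite -[leLHS]mulr1; apply: ler_pM => //; exact: le_trans h.
Qed.

Definition shift_digits n b : nat -> nat := fun i => b (n + i)%N.

Lemma mkseqD b m n : mkseq b (m + n) = mkseq b m ++ mkseq (shift_digits m b) n.
Proof.
rewrite /mkseq iotaD map_cat add0n; congr cat.
by rewrite -{1}(addn0 m) iotaDl -map_comp.
Qed.

Lemma all_pos_mkseq b n : (forall i, (0 < b i)%N) -> all_pos (mkseq b n).
Proof. by move=> bp; apply/allP => c /mapP[i _ ->]; exact: bp. Qed.

Lemma finite_cf_bound s : all_pos s -> 0 <= (finite_cf s : K) <= 1.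
Proof.
by move=> sp; rewrite finite_cfE cf_ge0 // cf_le1 // lexx ler01.
Qed.

Lemma cvg_natP (u : nat -> K) (l : K) : u n @[n --> \oo] --> l <->
  forall e, 0 < e -> exists N, forall n, (N <= n)%N -> `|u n - l| <= e.
Proof.
rewrite cvgrPdist_le; split=> h e e0.
  by have [N _ hN] := h e e0; exists N => n Nn; rewrite distrC; exact: hN.
by have [N hN] := h e e0; exists N => // n /= Nn; rewrite distrC; exact: hN.
Qed.

Lemma exists_nat_gt (a : K) : exists n : nat, (0 < n)%N /\ a < n%:R.
Proof.
exists (Num.truncn `|a|).+1; split=> //.
apply: le_lt_trans (ler_norm a) _.
by have /andP[] := truncn_itv (normr_ge0 a).
Qed.

(** From index N on, the convergents lie in the image of [0, 1] under [cf (mkseq b N)], whose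
    diameter is at most 1 / N; hence they form a Cauchy sequence. *)
Lemma cf_expansion_exists b : (forall i, (0 < b i)%N) ->
  exists2 x : K, cf_expansion b x & 0 <= x <= 1.
Proof.
move=> bp.
have bnd n : 0 <= (finite_cf (mkseq b n) : K) <= 1.
  exact/finite_cf_bound/all_pos_mkseq.
suff h : cvgn (fun n => finite_cf (mkseq b n) : K).
  exists (limn (fun n => finite_cf (mkseq b n) : K)); first by split.
  apply/andP; split.
    by apply: limr_ge => //; apply: nearW => n; have /andP[] := bnd n.
  by apply: limr_le => //; apply: nearW => n; have /andP[] := bnd n.
apply/cauchy_cvgP; apply/cauchy_exP => e e0.
have [N [N0 hN]] := exists_nat_gt e^-1.
exists (finite_cf (mkseq b N)); exists N => // n /= Nn.
rewrite /ball /= -(subnKC Nn) mkseqD !finite_cfE cf_cat.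
have bp' : forall i, (0 < shift_digits N b i)%N by move=> i; exact: bp.
have := finite_cf_bound (all_pos_mkseq (n - N) bp'); rewrite finite_cfE => h.
have h0 : 0 <= (0 : K) <= 1 by rewrite lexx ler01.
have := cf_dist_size (all_pos_mkseq N bp) h0 h; rewrite size_mkseq.
rewrite -ler_pdivlMr ?ltr0n // mul1r => /le_lt_trans; apply.
by rewrite invf_plt ?posrE // ltr0n.
Qed.

Lemma cf_expansion_unique b x y : cf_expansion b x -> cf_expansion b y -> x = y.
Proof. by move=> [_ h] [_ h']; exact: (cvg_unique (@norm_hausdorff _ K)) h h'. Qed.

(** The convergents of [x] are images of those of the tail, and [cf w] does not increase distances
    since [den] is at least 1. *)
Lemma cf_expansion_shift n b x : cf_expansion b x ->
  exists y, [/\ cf_expansion (shift_digits n b) y, 0 <= y <= 1 &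
    x = cf (mkseq b n) y].
Proof.
move=> [bp bx].
have bp' i : (0 < shift_digits n b i)%N by exact: bp.
have [y yx y01] := cf_expansion_exists bp'; exists y; split=> //.
apply: (@cf_expansion_unique b); split => //; apply/cvg_natP => e e0.
have [_ /cvg_natP/(_ e e0)[N hN]] := yx.
exists (n + N)%N => m nm; have nm' : (n <= m)%N by exact: leq_trans (leq_addr _ _) nm.
rewrite -(subnKC nm') mkseqD !finite_cfE cf_cat -!finite_cfE.
have /andP[y0 y1] := y01.
have bpn := all_pos_mkseq n bp.
have /andP[v0 v1] := finite_cf_bound (all_pos_mkseq (m - n) bp').
rewrite cf_dist //; apply: le_trans (hN (m - n)%N _); last by rewrite leq_subRL.
rewrite ler_pdivrMr ?mulr_gt0 ?den_gt0 // -[leLHS]mulr1 ler_wpM2l //.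
by rewrite -[leLHS]mulr1 ler_pM ?den_ge1.
Qed.

Lemma cf_expansion_head b x : cf_expansion b x ->
  exists y, [/\ cf_expansion (shift_digits 1 b) y, 0 <= y <= 1 &
    x = ((b 0%N)%:R + y)^-1].
Proof. exact: (@cf_expansion_shift 1). Qed.

Lemma cf_expansion_gt0 b x : cf_expansion b x -> 0 < x.
Proof.
move=> bx; have [bp _] := bx; have [y [_ /andP[y0 _] ->]] := cf_expansion_head bx.
by rewrite invr_gt0 ltr_pwDl ?ltr0n.
Qed.

Lemma cf_expansion_lt1 b x : cf_expansion b x -> x < 1.
Proof.
move=> bx; have [bp _] := bx.
have [y [/cf_expansion_gt0 y0 _ ->]] := cf_expansion_head bx.
by have b1 := natr_ge1 (bp 0%N); rewrite invf_lt1; lra.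
Qed.

Lemma cf_expansion_digits_unique b d x :
  cf_expansion b x -> cf_expansion d x -> b = d.
Proof.
move=> bx dx; apply/funext => n; elim: n b d x bx dx => [|n IH] b d x bx dx;
  have [y [by_ _ xy]] := cf_expansion_head bx;
  have [z [dz _ xz]] := cf_expansion_head dx.
all: have e : (b 0%N)%:R + y = (d 0%N)%:R + z by apply: invr_inj; rewrite -xy.
all: have y0 := cf_expansion_gt0 by_; have y1 := cf_expansion_lt1 by_.
all: have z0 := cf_expansion_gt0 dz; have z1 := cf_expansion_lt1 dz.
all: have e0 : b 0%N = d 0%N.
1,3: have h1 : (b 0 < (d 0).+1)%N by rewrite -(ltr_nat K) -natr1; lra.
1,2: have h2 : (d 0 < (b 0).+1)%N by rewrite -(ltr_nat K) -natr1; lra.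
1,2: by apply/eqP; rewrite eqn_leq -ltnS h1 -ltnS h2.
  by [].
have yz : y = z by move: e; rewrite e0 => /addrI.
by rewrite -yz in dz; exact: (IH _ _ _ by_ dz).
Qed.

Lemma cf_expansion_partial_quotient b x n : cf_expansion b x ->
  partial_quotient n.+1 x = b n.
Proof.
move=> bx; rewrite /partial_quotient /=.
by rewrite (@xget_unique _ _ _ b bx) // => d dx; exact: (cf_expansion_digits_unique dx bx).
Qed.

(** Euclidean descent: if x = m / n, the tail after the first digit is (n - b_0 m) / m, a quotient
    with the smaller denominator m. *)
Lemma cf_expansion_not_quotient b x (m n : nat) : cf_expansion b x ->
  (0 < n)%N -> x * n%:R <> m%:R.
Proof.
elim/ltn_ind: n m b x => n IH m b x bx n0 e.
have x0 := cf_expansion_gt0 bx; have x1 := cf_expansion_lt1 bx.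
have m0 : (0 < m)%N by rewrite -(ltr0n K) -e mulr_gt0 ?ltr0n.
have mn : (m < n)%N by rewrite -(ltr_nat K) -e gtr_pMl ?ltr0n.
have [y [by_ _ xy]] := cf_expansion_head bx.
have y0 := cf_expansion_gt0 by_.
have [bp _] := bx.
have e' : y * m%:R = n%:R - (b 0%N)%:R * m%:R.
  rewrite -e xy; have := natr_ge1 (bp 0%N) => ?; field; rewrite gt_eqF //; lra.
have le : (b 0 * m <= n)%N.
  rewrite -(ler_nat K) natrM -subr_ge0 -e' mulr_ge0 // ltW //.
by apply: (IH m mn (n - b 0 * m)%N _ y by_ m0); rewrite natrB // natrM.
Qed.

Lemma cf_expansion_irrational b x : cf_expansion b x -> irrational x.
Proof.
move=> bx [q _ qx].
have x0 := cf_expansion_gt0 bx.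
have q0 : 0 < numq q by rewrite numq_gt0 -(@ltr0q K) qx.
have d0 := denq_gt0 q.
apply: (@cf_expansion_not_quotient b x `|numq q|%N `|denq q|%N bx).
  by rewrite absz_gt0 gt_eqF.
rewrite !natr_absz !gtr0_norm // -qx /ratr.
by rewrite divfK // intr_eq0 gt_eqF.
Qed.

End continued_fraction_basics.

Notation all_pos := (all (leq 1)).

(** * Hausdorff measure *)

Section hausdorff_tools.
Context {K : realType}.
Implicit Types (s e C : K) (A U : set K).
Local Open Scope ereal_scope.

Lemma diameter_ge0 U : 0 <= diameter U.
Proof. by apply: ereal_sup_ubound; left. Qed.

Lemma diameter_ub U (x y : K) : U x -> U y -> `|x - y|%:E <= diameter U.
Proof. by move=> Ux Uy; apply: ereal_sup_ubound; right; exists x => //; exists y. Qed.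

Lemma diameter_le U (r : K) : (0 <= r)%R ->
  (forall x y, U x -> U y -> (`|x - y| <= r)%R) -> diameter U <= r%:E.
Proof.
move=> r0 h; apply: ge_ereal_sup => _ [->|[x Ux [y Uy <-]]].
  by rewrite lee_fin.
by rewrite lee_fin h.
Qed.

Lemma hausdorff_weight_ge0 s U : 0 <= hausdorff_weight s U.
Proof. by rewrite /hausdorff_weight; case: ifP => // _; exact: poweR_ge0. Qed.

Lemma hausdorff_weight_le s U (r : K) : (0 <= s)%R -> (0 <= r)%R ->
  (forall x y, U x -> U y -> (`|x - y| <= r)%R) ->
  hausdorff_weight s U <= (r `^ s)%:E.
Proof.
move=> s0 r0 h; rewrite /hausdorff_weight; case: ifP => _.
  by rewrite lee_fin powR_ge0.
rewrite -poweR_EFin; apply: gt0_ler_poweR => //; last exact: diameter_le.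
- by rewrite in_itv /= diameter_ge0 leey.
- by rewrite in_itv /= lee_fin r0 leey.
Qed.

(** The mesh condition comes for free: a cover of total weight at most d^s has only sets of diameter
    at most d. *)
Lemma hausdorff_measure_eq0 s A : (0 < s)%R ->
  (forall e, (0 < e)%R -> exists U : nat -> set K, A `<=` \bigcup_i U i /\
    \sum_(0 <= i <oo) hausdorff_weight s (U i) <= e%:E) ->
  hausdorff_measure s A = 0.
Proof.
move=> s0 h; apply/eqP; rewrite eq_le; apply/andP; split; last first.
  apply: (@le_trans _ _ (hausdorff_premeasure s 1 A)).
    apply: le_ereal_inf_tmp => _ [U _ <-].
    by apply: nneseries_ge0 => *; exact: hausdorff_weight_ge0.
  by apply: ereal_sup_ubound; exists 1%R => //=.
apply: ge_ereal_sup => _ [d d0 <-] /=.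
apply/lee_addgt0Pr => e e0; rewrite add0e.
have m0 : (0 < Num.min e (d `^ s))%R by rewrite lt_min e0 powR_gt0.
have [U [AU Ue]] := h _ m0.
apply: ge_ereal_inf; exists (\sum_(0 <= i <oo) hausdorff_weight s (U i)); last first.
  by apply: le_trans Ue _; rewrite lee_fin ge_min lexx.
exists U => //; split=> // i.
have wi : hausdorff_weight s (U i) <= (d `^ s)%:E.
  apply: (@le_trans _ _ (\sum_(0 <= i <oo) hausdorff_weight s (U i))); last first.
    by apply: le_trans Ue _; rewrite lee_fin ge_min lexx orbT.
  apply: le_trans (nneseries_lim_ge i.+1 _) => [|k _ _]; last exact: hausdorff_weight_ge0.
  rewrite big_nat_recr //= leeDr // sume_ge0 // => k _; exact: hausdorff_weight_ge0.
apply: diameter_le => [|x y Ux Uy]; first exact: ltW.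
rewrite leNgt; apply/negP => dxy.
move: wi; rewrite /hausdorff_weight ifF; last first.
  by apply/negbTE/set0P; exists x.
apply/negP; rewrite -ltNge.
apply: (@lt_le_trans _ _ (`|x - y|%:E `^ s)).
  by rewrite poweR_EFin lte_fin gt0_ltr_powR // nnegrE ltW // (lt_trans d0).
apply: gt0_ler_poweR; [exact: ltW| | |exact: diameter_ub].
- by rewrite in_itv /= lee_fin normr_ge0 leey.
- by rewrite in_itv /= diameter_ge0 leey.
Qed.

(* Pulls a cover of [A] back to a cover of [0, 1) and compares with Lebesgue
   measure. *)
Lemma hausdorff_measure_holder_neq0 s C A (G : K -> K) : (0 <= s)%R -> (0 < C)%R ->
  (forall y, (0 <= y < 1)%R -> A (G y)) ->
  (forall y z, (0 <= y < 1)%R -> (0 <= z < 1)%R ->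
     (`|y - z| <= C * `|G y - G z| `^ s)%R) ->
  hausdorff_measure s A <> 0.
Proof.
move=> s0 C0 GA GH HA.
have : hausdorff_premeasure s 1 A <= 0.
  by rewrite -HA; apply: ereal_sup_ubound; exists 1%R => //=.
(* The pulled-back intervals have length at most 2 C times the weight, so this threshold makes their
   total length at most 1/2, less than the length of [0, 1). *)
move=> /le_lt_trans - /(_ (4 * C)^-1%:E); rewrite lte_fin invr_gt0 mulr_gt0 //.
move=> /(_ isT)/ereal_inf_lt[_ [U [Ud AU] <-]] Us.
pose P i := [set y : K | (0 <= y < 1)%R /\ U i (G y)].
pose r i := (C * fine (diameter (U i)) `^ s)%R.
(* [P i] may fail to be measurable; it is enclosed in an interval centred at one of its points. *)
pose B i := if P i == set0 then set0
  else `[(xget 0 (P i) - r i)%R, (xget 0 (P i) + r i)%R]%classic.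
have Umax y z i : P i y -> P i z -> (`|y - z| <= r i)%R.
  move=> [y01 Uy] [z01 Uz]; apply: le_trans (GH _ _ y01 z01) _.
  rewrite ler_pM2l // ge0_ler_powR //.
    by rewrite nnegrE fine_ge0 ?diameter_ge0.
  rewrite -lee_fin fineK; first exact: diameter_ub.
  by rewrite fin_real // (lt_le_trans _ (diameter_ge0 _)) //= (le_lt_trans (Ud i)) ?ltry.
have cover : `[0%R, 1%R[%classic `<=` \bigcup_i B i.
  move=> y /=; rewrite in_itv /= => y01; have [i _ Ui] := AU _ (GA _ y01).
  have Piy : P i y by [].
  exists i => //; rewrite /B ifF; last by apply/negbTE/set0P; exists y.
  have Pg : P i (xget 0%R (P i)) by apply: xgetPex; exists y.
  by rewrite /= in_itv /= -ler_distlC; exact: Umax.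
have mB i : measurable (B i) by rewrite /B; case: ifP => _ //; exact: measurable_itv.
have BU i : lebesgue_measure (B i) <= (2 * C)%:E * hausdorff_weight s (U i).
  rewrite /B; case: ifP => [_|/negbT Pi].
    by rewrite measure0 mule_ge0 ?hausdorff_weight_ge0 // lee_fin; lra.
  have [y [y01 Uy]] : P i !=set0 by apply/set0P.
  rewrite lebesgue_measure_itv /= lte_fin.
  have r0 : (0 <= r i)%R by rewrite mulr_ge0 ?powR_ge0 // ltW.
  have -> : hausdorff_weight s (U i) = diameter (U i) `^ s.
    by rewrite /hausdorff_weight ifF //; apply/negbTE/set0P; exists (G y).
  have -> : diameter (U i) = (fine (diameter (U i)))%:E.
    by rewrite fineK // fin_real // (lt_le_trans _ (diameter_ge0 _)) //= (le_lt_trans (Ud i)) ?ltry.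
  rewrite poweR_EFin -EFinM; case: ifP => _; rewrite -?EFinB lee_fin.
    by rewrite -mulrA -/(r i); lra.
  by rewrite -mulrA -/(r i); lra.
have : lebesgue_measure (`[0%R, 1%R[%classic : set K) <=
    \sum_(0 <= i <oo) lebesgue_measure (B i).
  exact: (measure_sigma_subadditive (@lebesgue_measure K) mB
    (measurable_itv `[0%R, 1%R[) cover).
apply/negP; rewrite -ltNge lebesgue_measure_itv /= lte01 oppr0 adde0.
apply: (@le_lt_trans _ _ (\sum_(0 <= i <oo) (2 * C)%:E * hausdorff_weight s (U i))).
  by apply: lee_nneseries => // *; exact: BU.
rewrite nneseriesZl; last by move=> *; exact: hausdorff_weight_ge0.
apply: (@le_lt_trans _ _ ((2 * C)%:E * (4 * C)^-1%:E)).
  by apply: lee_wpmul2l; [rewrite lee_fin; lra | exact: ltW].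
rewrite -EFinM lte_fin; have -> : (2 * C / (4 * C) = 2^-1)%R by field; rewrite gt_eqF.
by lra.
Qed.

End hausdorff_tools.

(** * Dimension bounds from covers, and sums over words *)

Section covers.
Context {K : realType}.
Implicit Types (s e : K) (A : set K).

Lemma powR_invbase (x a : K) : 0 <= x -> x^-1 `^ a = (x `^ a)^-1.
Proof. by move=> x0; rewrite -powR_inv1 // -powRrM mulN1r powRN. Qed.

Lemma powR_addexp (x a b : K) : 0 < x -> x `^ (a + b) = x `^ a * x `^ b.
Proof. by move=> x0; rewrite powRD // (gt_eqF x0) implybT. Qed.

Lemma hausdorff_dim_le s A : 0 <= s ->
  (forall t, s < t -> hausdorff_measure t A = 0%E) -> (hausdorff_dim A <= s%:E)%E.
Proof.
move=> s0 h; apply/lee_addgt0Pr => e e0; rewrite -EFinD.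
apply: ereal_inf_lbound; exists (s + e); [|by []].
by split; [exact: addr_ge0 s0 (ltW e0) | apply: h; rewrite ltrDl].
Qed.

Lemma hausdorff_dim_ge s A :
  (forall t, 0 <= t < s -> hausdorff_measure t A <> 0%E) -> (s%:E <= hausdorff_dim A)%E.
Proof.
move=> h; apply: le_ereal_inf_tmp => _ [t [t0 ht] <-].
rewrite lee_fin leNgt; apply/negP => ts; apply: (h t) => //.
by rewrite t0 ts.
Qed.

Lemma nneseries_le (u : nat -> \bar K) (M : \bar K) : (forall n, (0 <= u n)%E) ->
  (forall n, (\sum_(0 <= i < n) u i <= M)%E) -> (\sum_(0 <= i <oo) u i <= M)%E.
Proof.
move=> u0 h; apply: lime_le; first exact: is_cvg_nneseries.
by apply: nearW => n; exact: h.
Qed.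

Lemma hausdorff_measure_gt1 s A : 1 < s -> (forall x, A x -> 0 <= x < 1) ->
  hausdorff_measure s A = 0%E.
Proof.
move=> s1 A01; apply: hausdorff_measure_eq0 => [|e e0]; first lra.
(* N intervals of length 1 / N have total weight N^(1 - s), which is at most e for this N. *)
have [N [N0 hN]] := exists_nat_gt (e^-1 `^ (s - 1)^-1).
have N0' : 0 < N%:R :> K by rewrite ltr0n.
pose U i : set K := if (i < N)%N then `[i%:R / N%:R, i.+1%:R / N%:R]%classic else set0.
have wU i : (hausdorff_weight s (U i) <=
    (if (i < N)%N then N%:R^-1 `^ s else 0)%:E)%E.
  rewrite /U; case: ifP => iN; last by rewrite /hausdorff_weight eqxx.
  apply: hausdorff_weight_le => [||x y /=]; rewrite ?invr_ge0 ?in_itv //=; first lra.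
  move=> /andP[x1 x2] /andP[y1 y2].
  have : i.+1%:R / N%:R = i%:R / N%:R + N%:R^-1 :> K by rewrite -natr1 mulrDl mul1r.
  by move=> E; rewrite E in x2 y2; rewrite ler_norml; apply/andP; split; lra.
exists U; split=> [x /A01/andP[x0 x1]|].
  exists (Num.truncn (x * N%:R)) => //.
  have xN : 0 <= x * N%:R by rewrite mulr_ge0.
  have /andP[h1 h2] := truncn_itv xN.
  rewrite /U ifT; last first.
    by rewrite -(ltr_nat K); apply: le_lt_trans h1 _; rewrite gtr_pMl.
  by rewrite /= in_itv /= ler_pdivrMr // h1 ler_pdivlMr // ltW.
apply: (@le_trans _ _ (N%:R * N%:R^-1 `^ s)%:E); last first.
  rewrite powR_invbase ?(ltW N0') //.
  have -> : N%:R `^ s = N%:R * N%:R `^ (s - 1) :> K.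
    by rewrite -{2}(powRr1 (ltW N0')) -powR_addexp //; congr powR; lra.
  have P0 : 0 < N%:R `^ (s - 1) :> K by rewrite powR_gt0.
  rewrite lee_fin invfM mulVKf ?gt_eqF // invf_ple ?posrE //.
  have -> : e^-1 = (e^-1 `^ (s - 1)^-1) `^ (s - 1).
    by rewrite -powRrM mulVf ?powRr1 ?invr_ge0 ?ltW // gt_eqF // subr_gt0.
  by apply: ge0_ler_powR; rewrite ?nnegrE ?powR_ge0 ?subr_ge0 ?ltW.
apply: nneseries_le => [i|n]; first exact: hausdorff_weight_ge0.
apply: (@le_trans _ _ ((minn n N)%:R * N%:R^-1 `^ s)%:E); last first.
  by rewrite lee_fin ler_wpM2r ?powR_ge0 // ler_nat geq_minr.
elim: n => [|n IH]; first by rewrite big_nil min0n mul0r.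
rewrite big_nat_recr //=; apply: le_trans (leeD IH (wU n)) _.
rewrite -EFinD lee_fin; case: ifP => nN.
  have -> : minn n N = n by lia.
  have -> : minn n.+1 N = n.+1 by lia.
  by rewrite -natr1 mulrDl mul1r.
by rewrite addr0 ler_wpM2r ?powR_ge0 // ler_nat; lia.
Qed.

Lemma esum_scale_le (T : choiceType) (I : set T) (f : T -> \bar K) (c : K) :
  0 <= c -> (forall i, (0 <= f i)%E) ->
  (\esum_(i in I) (c%:E * f i) <= c%:E * \esum_(i in I) f i)%E.
Proof.
move=> c0 f0; apply: ge_ereal_sup => _ [X XI <-].
rewrite -ge0_mule_fsumr //; apply: lee_wpmul2l; first by rewrite lee_fin.
by apply: ereal_sup_ubound; exists X.
Qed.

(** Splitting off the first digit shows that words of length n contribute at most the n-th power of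
    the digit sum, so the total is bounded by the geometric series of ratio 1/2. *)
Lemma esum_words (v : nat -> K) : (forall a, 0 <= v a) ->
  (forall n, \sum_(0 <= a < n) v a <= 2^-1) ->
  (\esum_(w in [set: seq nat]) (\prod_(a <- w) v a)%:E <= 2%:E)%E.
Proof.
move=> v0 hv.
have p0 (w : seq nat) : (0 <= (\prod_(a <- w) v a)%:E)%E.
  by rewrite lee_fin prodr_ge0.
pose W n := [set w : seq nat | size w = n].
have hW n : (\esum_(w in W n) (\prod_(a <- w) v a)%:E <= (2^-1 ^+ n)%:E)%E.
  elim: n => [|n IH].
    have -> : W 0%N = [set [::]].
      by apply/seteqP; split => w /=; [move/size0nil | move->].
    by rewrite esum_set1 // big_nil expr0.
  rewrite (@reindex_esum _ _ _ ([set: nat] `*`` (fun=> W n)) _ (fun p => p.1 :: p.2)); last first.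
    split=> [[a w] [_ /= <-]|[a w] [b w'] _ _ /= [-> ->]|[|a w] //= [wn]] //.
    by exists (a, w).
  rewrite (eq_esum (b := fun p : nat * seq nat =>
      ((v p.1)%:E * (\prod_(a <- p.2) v a)%:E)%E)); last first.
    by move=> p _; rewrite big_cons EFinM.
  rewrite -(@esum_esum _ _ _ _ _ (fun a w => ((v a)%:E * (\prod_(c <- w) v c)%:E)%E)); last first.
    by move=> a w _ _; rewrite mule_ge0 // lee_fin.
  apply: (@le_trans _ _ (\esum_(a in [set: nat]) ((v a)%:E * (2^-1 ^+ n)%:E))%E).
    apply: le_esum => a _; apply: le_trans (esum_scale_le _ _ _) _ => //.
    by rewrite lee_wpmul2l // lee_fin.
  rewrite -nneseries_esumT; last first.
    by move=> a; rewrite -EFinM lee_fin mulr_ge0 // exprn_ge0.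
  apply: nneseries_le => [a|m].
    by rewrite -EFinM lee_fin mulr_ge0 // exprn_ge0.
  under eq_bigr do rewrite -EFinM.
  rewrite sumEFin lee_fin -mulr_suml exprS ler_wpM2r // exprn_ge0 //.
have -> : [set: seq nat] = \bigcup_n W n.
  by apply/seteqP; split => w // _; exists (size w).
rewrite nneseries_sum_bigcup //; last first.
  apply/trivIsetP => i j _ _ ij; apply/seteqP; split=> // w [/= wi wj].
  by move: ij; rewrite -wi -wj eqxx.
apply: nneseries_le => [n|n]; first by apply: esum_ge0 => *.
apply: le_trans (lee_sum _ (fun i _ => hW i)) _.
rewrite sumEFin lee_fin.
suff -> : \sum_(0 <= i < n) 2^-1 ^+ i = 2 - 2 * 2^-1 ^+ n :> K.
  by rewrite gerBl mulr_ge0 // exprn_ge0.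
elim: n => [|n IH]; first by rewrite big_nil expr0; lra.
by rewrite big_nat_recr //= IH exprS; lra.
Qed.

End covers.

(** * Null sets of points with large digit products *)

Section growth_of_products.
Context {K : realType}.
Implicit Types (s e : K) (A : set K).

(** Integral comparison in telescoped form: y^(-1-d) is at most the integral of t^(-1-d) over
    [y - 1, y], which is ((y-1)^(-d) - y^(-d)) / d. The digit 0 gets weight 0. *)
Lemma sum_powR_le (d : K) n : 0 < d ->
  \sum_(0 <= a < n) (if a == 0%N then 0 else a%:R `^ (- (1 + d))) <= 1 + d^-1.
Proof.
move=> d0; have dV : 0 < d^-1 by rewrite invr_gt0.
case: n => [|[|n]]; first by rewrite big_nil addr_ge0 // ltW.
  by rewrite big_nat1 /= addr_ge0 // ltW.
suff h : \sum_(0 <= a < n.+2) (if a == 0%N then 0 else a%:R `^ (- (1 + d)))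
    <= 1 + d^-1 * (1 - n.+1%:R `^ (- d)).
  by apply: le_trans h _; rewrite lerD2l ger_pMr // gerBl powR_ge0.
elim: n => [|n IH].
  by rewrite big_nat_recr // big_nat1 /= !powR1 add0r subrr mulr0 addr0.
rewrite big_nat_recr //=; apply: le_trans (lerD IH (lexx _)) _.
set x : K := n.+1%:R; set y : K := n.+2%:R.
have x0 : 0 < x by rewrite ltr0n.
have yx : y = x + 1 by rewrite natr1.
have y0 : 0 < y by rewrite ltr0n.
have h1 : y `^ (- (1 + d)) = y^-1 * y `^ (- d).
  by rewrite opprD powR_addexp // powR_inv1 // ltW.
have h2 : x `^ (- d) = y `^ (- d) * (y / x) `^ d.
  rewrite powRM ?(ltW y0) ?invr_ge0 ?(ltW x0) // powR_invbase ?(ltW x0) //.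
  by rewrite mulrA -powR_addexp // addNr powRr0 mul1r powRN.
have h3 : 1 + d * y^-1 <= (y / x) `^ d.
  rewrite /powR gt_eqF ?divr_gt0 //; apply: le_trans (expR_ge1Dx _).
  rewrite lerD2l ler_pM2l // -[y / x]invrK lnV ?posrE ?invr_gt0 ?divr_gt0 //.
  have -> : (y / x)^-1 = 1 + - y^-1 by rewrite yx; field; rewrite !gt_eqF //; lra.
  rewrite lerNr; apply: le_ln1Dx.
  by rewrite ltrN2 invf_lt1 // yx; lra.
have h4 : y^-1 * y `^ (- d) <= d^-1 * (x `^ (- d) - y `^ (- d)).
  have p0 : 0 < y `^ (- d) by rewrite powR_gt0.
  rewrite h2 -(ler_pM2l d0) [leRHS]mulVKf ?gt_eqF //.
  have -> : y `^ (- d) * (y / x) `^ d - y `^ (- d) = ((y / x) `^ d - 1) * y `^ (- d) by ring.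
  by rewrite mulrA ler_pM2r //; rewrite lerBrDl.
rewrite -addrA lerD2l; apply: le_trans (lerD (lexx _) (_ : _ <= d^-1 * (x `^ (- d) - y `^ (- d)))) _.
  by rewrite -h1 in h4; exact: h4.
by rewrite -mulrDr ler_pM2l //; lra.
Qed.

Lemma powR_prod (w : seq nat) (a : K) :
  (\prod_(c <- w) c%:R) `^ a = \prod_(c <- w) (c%:R `^ a) :> K.
Proof.
elim: w => [|c w IH]; first by rewrite !big_nil powR1.
by rewrite !big_cons powRM ?IH // prodr_ge0.
Qed.

(** With d = s - 1/2 and P the digit product, P^(-2s) = P^(-(1+d)) P^(-d). The first factor is
    summable digit by digit; the second is at most E^(-d) per digit, which pays for normalizing the
    digit sum to 1/2 and leaves a factor 2^(-N) to spare. *)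
Lemma hausdorff_measure_large_products s A : 2^-1 < s ->
  (forall E : K, 0 < E -> forall N : nat, forall x, A x -> exists w : seq nat,
     [/\ all_pos w, (N <= size w)%N, E ^+ size w <= \prod_(c <- w) c%:R &
         exists2 t, 0 <= t <= 1 & x = cf w t]) ->
  hausdorff_measure s A = 0%E.
Proof.
move=> s2 hA; pose d := s - 2^-1; have d0 : 0 < d by rewrite /d; lra.
pose Z := 1 + d^-1; have Z0 : 0 < Z by rewrite ltr_wpDr ?invr_ge0 // ltW.
(* Chosen so that E^(-d) = 1 / (4 Z): the part 1 / (2 Z) normalizes the digit sum, whose bound is Z,
   and the part 1/2 yields 2^(-N). *)
pose E := (4 * Z) `^ d^-1.
have Z40 : 0 < 4 * Z by rewrite mulr_gt0.
have E0 : 0 < E by rewrite powR_gt0.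
have Ed : E `^ (- d) = (4 * Z)^-1.
  by rewrite -powRrM mulrN mulVf ?gt_eqF // powR_inv1 // ltW.
pose v (a : nat) : K := if a == 0%N then 0 else a%:R `^ (- (1 + d)).
have v0 a : 0 <= v a by rewrite /v; case: ifP => // _; exact: powR_ge0.
pose v' a : K := (2 * Z)^-1 * v a.
have Z2 : 0 < (2 * Z)^-1 by rewrite invr_gt0 mulr_gt0.
have v'0 a : 0 <= v' a by rewrite mulr_ge0 // ltW.
have hv' n : \sum_(0 <= a < n) v' a <= 2^-1.
  rewrite -mulr_sumr; apply: le_trans (_ : (2 * Z)^-1 * Z <= _).
    by rewrite ler_pM2l //; exact: sum_powR_le.
  by rewrite invfM mulfVK ?gt_eqF.
apply: hausdorff_measure_eq0 => [|e e0]; first lra.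
have [N [N0 hN]] := exists_nat_gt (2 / e).
pose good (w : seq nat) := [&& all_pos w, (N <= size w)%N &
  E ^+ size w <= \prod_(c <- w) c%:R].
pose V (w : seq nat) : set K :=
  if good w then [set cf w t | t in [set t | 0 <= t <= 1]] else set0.
have wV w : (hausdorff_weight s (V w) <= (2^-1 ^+ N * \prod_(c <- w) v' c)%:E)%E.
  rewrite /V; case: ifPn => [/and3P[wp wN wE]|_]; last first.
    rewrite /hausdorff_weight eqxx lee_fin mulr_ge0 ?exprn_ge0 //.
    by apply: prodr_ge0 => i _; exact: v'0.
  set P : K := \prod_(c <- w) c%:R in wE.
  have P0 : 0 < P by apply: lt_le_trans wE; rewrite exprn_gt0.
  apply: le_trans (@hausdorff_weight_le _ s _ (P ^- 2) _ _ _) _; first lra.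
  - by rewrite invr_ge0 exprn_ge0 // ltW.
  - move=> _ _ [t /andP[t0 t1] <-] [u /andP[u0 u1] <-]; rewrite cf_dist //.
    rewrite -[leRHS]mul1r; apply: ler_pM => //.
    + by rewrite invr_ge0 mulr_ge0 // ltW // den_gt0.
    + by apply: dist_unit_le1; apply/andP.
    + rewrite lef_pV2 ?posrE ?exprn_gt0 ?mulr_gt0 ?den_gt0 //.
      by rewrite expr2 ler_pM ?den_ge_prod // ltW.
  rewrite lee_fin powR_invbase ?exprn_ge0 ?(ltW P0) //.
  have -> : ((P ^+ 2) `^ s)^-1 = P `^ (- (1 + d)) * P `^ (- d).
    rewrite -powR_mulrn ?(ltW P0) // -powRrM -powRN -powR_addexp //; congr powR.
    by rewrite /d; field.
  have h1 : P `^ (- d) <= ((4 * Z)^-1) ^+ size w.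
    rewrite -Ed -powR_mulrn ?powR_ge0 // -powRrM mulrC powRrM powR_mulrn ?(ltW E0) //.
    rewrite !powRN lef_pV2 ?posrE ?powR_gt0 ?exprn_gt0 //.
    by apply: ge0_ler_powR; rewrite ?nnegrE ?exprn_ge0 ?(ltW d0) ?(ltW P0) ?(ltW E0).
  have h2 : P `^ (- (1 + d)) = \prod_(c <- w) v c.
    rewrite powR_prod; apply: eq_big_seq => c cw; rewrite /v ifF //.
    by move/allP : wp => /(_ c cw); case: c {cw}.
  have -> : \prod_(c <- w) v' c = (2 * Z)^-1 ^+ size w * \prod_(c <- w) v c.
    by rewrite /v' big_split /= big_const_seq iter_mulr_1 count_predT.
  rewrite h2 mulrC mulrA ler_wpM2r ?prodr_ge0 //.
  apply: le_trans h1 _.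
  have -> : (4 * Z)^-1 = 2^-1 * (2 * Z)^-1 by rewrite -invfM mulrA -natrM.
  rewrite exprMn ler_wpM2r ?exprn_ge0 ?(ltW Z2) //.
  by rewrite ler_wiXn2l //; lra.
(* The cover is indexed by codes of words; numbers that code no word get the empty set, of weight
   0. *)
exists (fun i => if pickle_inv i is Some w then V w else set0); split.
  move=> x Ax; have [w [wp wN wE [t t01 xt]]] := hA E E0 N x Ax.
  exists (pickle w) => //; rewrite pickleK_inv /V ifT; first by exists t.
  by apply/and3P.
have -> : (\sum_(0 <= i <oo) hausdorff_weight s (if pickle_inv i is Some w then V w else set0)
   = \esum_(w in [set: seq nat]) hausdorff_weight s (V w))%E.
  rewrite nneseries_esumT; last by move=> i; exact: hausdorff_weight_ge0.
  transitivity (\esum_(j in [set pickle w | w in [set: seq nat]])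
      hausdorff_weight s (if pickle_inv j is Some w then V w else set0))%E; last first.
    rewrite esum_image; last by move=> w w' _ _; exact: (pcan_inj (@pickleK _)).
    by apply: eq_esum => w _; rewrite pickleK_inv.
  rewrite [RHS]esum_mkcond; apply: eq_esum => i _; case: ifPn => // /negP ni.
  case F : (pickle_inv i) => [w|]; last by rewrite /hausdorff_weight eqxx.
  by exfalso; apply: ni; rewrite inE; exists w => //; have := @pickle_invK (seq nat) i; rewrite F.
apply: (@le_trans _ _ (\esum_(w in [set: seq nat]) ((2^-1 ^+ N)%:E * (\prod_(c <- w) v' c)%:E))%E).
  by apply: le_esum => w _; rewrite -EFinM.
apply: le_trans (esum_scale_le _ _ _) _.
- by rewrite exprn_ge0.
- by move=> w; rewrite lee_fin prodr_ge0.
apply: le_trans (lee_wpmul2l _ (esum_words v'0 hv')) _.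
  by rewrite lee_fin exprn_ge0.
rewrite -EFinM lee_fin exprVn ler_pdivrMl ?exprn_gt0 // -ler_pdivrMr //.
apply: le_trans (ltW hN) _; rewrite -natrX ler_nat ltnW // ltn_expl //.
Qed.

End growth_of_products.

(** * Mass distribution on trees of digits *)

Section digit_trees.
Context {K : realType}.
Implicit Types (w : seq nat) (b d : nat -> nat) (x y z t : K).

(* Length of the interval of numbers whose expansion begins with [w]. *)
Definition cyl_length w : K := (den w 0 * den w 1)^-1.

Lemma cyl_length_gt0 w : all_pos w -> 0 < cyl_length w.
Proof. by move=> wp; rewrite invr_gt0 mulr_gt0 ?den_gt0. Qed.

Lemma pick_subinterval (f : nat -> K) (m n : nat) y :
  0 <= y < \sum_(m <= i < n) f i ->
  exists c, (m <= c < n)%N /\ \sum_(m <= i < c) f i <= y < \sum_(m <= i < c.+1) f i.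
Proof.
elim: n => [|n IH] /andP[y0 yn]; first by move: (le_lt_trans y0 yn); rewrite big_geq // ltxx.
have [mn|nm] := leqP m n; last first.
  by move: (le_lt_trans y0 yn); rewrite big_geq // ltxx.
have [h|h] := leP (\sum_(m <= i < n) f i) y.
  by exists n; rewrite mn ltnSn h yn.
have [c [/andP[mc cn] hc]] := IH (introT andP (conj y0 h)).
by exists c; rewrite mc ltnS (ltnW cn).
Qed.

Section greedy.
Context (lo hi : nat -> nat) (p : seq nat -> nat -> K)
  (lo_gt0 : forall n, (0 < lo n)%N)
  (p_gt0 : forall w c, all_pos w -> (0 < c)%N -> 0 < p w c)
  (p_sum : forall w, all_pos w ->
    \sum_(lo (size w) <= c < (hi (size w)).+1) p w c = 1).

Definition containing_child w z : set nat :=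
  [set c | (lo (size w) <= c <= hi (size w))%N /\
    \sum_(lo (size w) <= i < c) p w i <= z < \sum_(lo (size w) <= i < c.+1) p w i].

Definition greedy_digit w z : nat := xget 0%N (containing_child w z).

(** As in a b-ary expansion with variable subdivision, the state is the word read so far together
    with the position of the point inside the corresponding mass interval, rescaled to [0, 1). *)
Definition greedy_step (wz : seq nat * K) : seq nat * K :=
  let c := greedy_digit wz.1 wz.2 in
  (rcons wz.1 c, (wz.2 - \sum_(lo (size wz.1) <= i < c) p wz.1 i) / p wz.1 c).

Definition greedy_state y n := iter n greedy_step ([::], y).

Definition greedy_digits y n := greedy_digit (greedy_state y n).1 (greedy_state y n).2.

Lemma greedy_digitP w z : all_pos w -> 0 <= z < 1 ->
  containing_child w z (greedy_digit w z).
Proof.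
move=> wp; rewrite -(p_sum wp) => /pick_subinterval[c hc].
by apply: xgetPex; exists c.
Qed.

Lemma greedy_state_word y n : (greedy_state y n).1 = mkseq (greedy_digits y) n.
Proof.
elim: n => // n IH.
by rewrite mkseqS -IH /greedy_digits /greedy_state iterS.
Qed.

Lemma greedy_stateP y n : 0 <= y < 1 ->
  all_pos (greedy_state y n).1 /\ 0 <= (greedy_state y n).2 < 1.
Proof.
move=> y01; elim: n => // n; rewrite /greedy_state iterS -/(greedy_state y n).
case: (greedy_state y n) => w z /= [wp z01].
have [/andP[h1 _] /andP[h2 h3]] := greedy_digitP wp z01.
have c0 : (0 < greedy_digit w z)%N by exact: leq_trans h1.
rewrite all_rcons c0 wp; split => //.
have pc := p_gt0 wp c0.
rewrite divr_ge0 ?subr_ge0 ?(ltW pc) //= ltr_pdivrMr // mul1r ltrBlDl.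
by rewrite big_nat_recr in h3.
Qed.

Lemma greedy_digits_bounds y n : 0 <= y < 1 ->
  (lo n <= greedy_digits y n <= hi n)%N.
Proof.
move=> y01; have [wp z01] := greedy_stateP n y01.
have [+ _] := greedy_digitP wp z01.
by rewrite greedy_state_word size_mkseq -greedy_state_word. 
Qed.

Lemma greedy_digits_gt0 y n : 0 <= y < 1 -> (0 < greedy_digits y n)%N.
Proof. by move=> y01; have /andP[+ _] := greedy_digits_bounds n y01; apply: leq_trans. Qed.

Lemma greedy_dist y z n : 0 <= y < 1 -> 0 <= z < 1 ->
  (forall i, (i < n)%N -> greedy_digits y i = greedy_digits z i) ->
  `|y - z| <= \prod_(i < n) p (mkseq (greedy_digits y) i) (greedy_digits y i).
Proof.
move=> y01 z01 yz.
suff -> : y - z = \prod_(i < n) p (mkseq (greedy_digits y) i) (greedy_digits y i) *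
    ((greedy_state y n).2 - (greedy_state z n).2).
  have P0 : 0 <= \prod_(i < n) p (mkseq (greedy_digits y) i) (greedy_digits y i).
    apply: prodr_ge0 => i _; apply: ltW; apply: p_gt0; last exact: greedy_digits_gt0.
    by apply: all_pos_mkseq => j; exact: greedy_digits_gt0.
  rewrite normrM ger0_norm // -[leRHS]mulr1 ler_wpM2l // ler_norml.
  have [_ /andP[? ?]] := greedy_stateP n y01.
  have [_ /andP[? ?]] := greedy_stateP n z01.
  by apply/andP; split; lra.
elim: n yz => [|n IH] yz; first by rewrite big_ord0 mul1r.
rewrite IH; last by move=> i lin; apply: yz; exact: ltnW.
have e1 : (greedy_state y n).1 = (greedy_state z n).1.
  rewrite !greedy_state_word; apply/eq_in_map => i.
  by rewrite mem_iota => /andP[_ lin]; apply: yz; exact: ltnW.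
have e2 := yz n (ltnSn n).
have c0 := greedy_digits_gt0 n y01.
have [wp _] := greedy_stateP n y01.
have pc := p_gt0 wp c0.
have stS t : (greedy_state t n.+1).2 = ((greedy_state t n).2 -
    \sum_(lo (size (greedy_state t n).1) <= i < greedy_digits t n) p (greedy_state t n).1 i) /
    p (greedy_state t n).1 (greedy_digits t n) by [].
rewrite big_ord_recr !stS /= -greedy_state_word -e2 -e1.
set P := \prod_(i < n) _; field.
by rewrite gt_eqF.
Qed.

End greedy.

(** After the common word the tails are 1 / (b_n + x2) and 1 / (d_n + y2), which nearly agree only
    if d_n = b_n + 1 with x2 near 1 and y2 near 0. A next digit of [b] at least 2 gives x2 <= 1/2,
    and a next digit of [d] at most M gives y2 >= 1 / (M + 1); either keeps the tails apart. The
    factor 2 compares [den w 1] with [den w 0]. *)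
Lemma expansion_separation b d x y n (h M : nat) : cf_expansion b x -> cf_expansion d y ->
  (forall i, (i < n)%N -> b i = d i) -> (b n < d n <= h)%N -> (0 < M)%N ->
  (2 <= b n.+1)%N \/ (d n.+1 <= M)%N ->
  cyl_length (mkseq b n) <= 2 * (M%:R + 1) * h.+1%:R ^+ 2 * `|x - y|.
Proof.
move=> bx dy bd /andP[bdn dh] M0 gap; have [bp _] := bx; have [dp _] := dy.
have ew : mkseq b n = mkseq d n.
  by apply/eq_in_map => i; rewrite mem_iota => /andP[_]; exact: bd.
have [x1 [bx1 /andP[x10 _] ->]] := cf_expansion_shift n bx.
have [y1 [dy1 /andP[y10 _] ->]] := cf_expansion_shift n dy.
have wp := all_pos_mkseq n bp; rewrite -ew; set w := mkseq b n in wp *.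
have [x2 [bx2 /andP[x20 x21] E1]] := cf_expansion_head bx1.
have [y2 [dy2 /andP[y20 y21] F1]] := cf_expansion_head dy1.
have [x3 [bx3 /andP[x30 x31] E2]] := cf_expansion_head bx2.
have [y3 [dy3 /andP[y30 y31] F2]] := cf_expansion_head dy2.
rewrite /shift_digits !addn0 ?addn1 in E1 F1 E2 F2.
have M1 : 1 <= M%:R :> K := natr_ge1 M0.
have gap_le : (M%:R + 1)^-1 <= 1 - x2 + y2.
  case: gap => gp.
    have : x2 <= 2^-1.
      rewrite E2 lef_pV2 ?posrE ?ltr0n //; last by rewrite ltr_pwDl ?ltr0n // bp.
      have : 2 <= (b n.+1)%:R :> K by rewrite ler_nat.
      lra.
    have : (M%:R + 1)^-1 <= 2^-1 :> K by rewrite lef_pV2 ?posrE; lra.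
    lra.
  have : (M%:R + 1)^-1 <= y2.
    rewrite F2 lef_pV2 ?posrE; first by rewrite lerD // ler_nat.
      lra.
    by rewrite ltr_pwDl ?ltr0n.
  lra.
have bdr : (b n)%:R + 1 <= (d n)%:R :> K by rewrite natr1 ler_nat.
have dhr : (d n)%:R + 1 <= h.+1%:R :> K by rewrite -natr1 lerD2r ler_nat.
move: (h.+1%:R : K) dhr => H dhr.
have b1 : 1 <= (b n)%:R :> K := natr_ge1 (bp n).
have X0 : 0 < (b n)%:R + x2 by lra.
have Y0 : 0 < (d n)%:R + y2 by lra.
have x1y1 : (M%:R + 1)^-1 <= H ^+ 2 * `|x1 - y1|.
  rewrite E1 F1; have -> : ((b n)%:R + x2)^-1 - ((d n)%:R + y2)^-1 =
    ((d n)%:R + y2 - ((b n)%:R + x2)) / (((b n)%:R + x2) * ((d n)%:R + y2)).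
    by field; rewrite !gt_eqF.
  rewrite ger0_norm; last by apply: divr_ge0; [lra|exact: mulr_ge0 (ltW X0) (ltW Y0)].
  rewrite mulrCA; apply: le_trans gap_le _; apply: le_trans (_ : (d n)%:R + y2 - ((b n)%:R + x2) <= _).
    lra.
  rewrite -[leLHS]mulr1 ler_wpM2l //; first lra.
  rewrite ler_pdivlMr ?mulr_gt0 // mul1r expr2; by apply: ler_pM; lra.
have q0 : 0 < den w (0 : K) by rewrite den_gt0.
have q1 : 0 < den w (1 : K) by rewrite den_gt0.
have /andP[q01 q2] := @den_le K _ wp.
have x101 : 0 <= x1 <= 1 by rewrite x10 ltW // (cf_expansion_lt1 bx1).
have y101 : 0 <= y1 <= 1 by rewrite y10 ltW // (cf_expansion_lt1 dy1).
have /andP[_ dx] := den_le_at1 wp x101.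
have /andP[_ dy_] := den_le_at1 wp y101.
rewrite cf_dist // /cyl_length.
have dx0 := den_gt0 x10 wp; have dy0 := den_gt0 y10 wp.
have : (M%:R + 1) * (H ^+ 2 * `|x1 - y1|) >= 1.
  by rewrite mulrC -ler_pdivrMr ?mul1r //; lra.
move=> big.
rewrite -div1r ler_pdivrMr ?mulr_gt0 //.
set a := H ^+ 2 * `|x1 - y1| in big *.
have -> : 2 * (M%:R + 1) * H ^+ 2 * (`|x1 - y1| / (den w x1 * den w y1)) * (den w 0 * den w 1)
  = ((M%:R + 1) * a) * ((2 * den w 0 * den w 1) / (den w x1 * den w y1)).
  by rewrite /a; field; rewrite !gt_eqF.
rewrite -[leLHS]mulr1 ler_pM // ler_pdivlMr ?mulr_gt0 // mul1r.
by apply: ler_pM => //; [exact: ltW|exact: ltW|lra].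
Qed.

End digit_trees.

(** * Positive Hausdorff measure for restricted digits *)

Section digit_restricted_sets.
Context {K : realType}.
Implicit Types (w : seq nat) (b d : nat -> nat) (x y z t : K).

Lemma holder_combine (sg Q H D l B C : K) :
  0 <= sg -> 0 <= Q -> 0 <= H -> 0 <= D -> 0 <= l -> 0 <= B ->
  l <= Q * H * D -> B * H `^ sg <= C -> B * l `^ sg <= C * Q `^ sg * D `^ sg.
Proof.
move=> sg0 Q0 H0 D0 l0 B0 lQ BC.
have h : l `^ sg <= Q `^ sg * H `^ sg * D `^ sg.
  rewrite -!powRM ?mulr_ge0 //.
  by apply: ge0_ler_powR; rewrite ?nnegrE ?mulr_ge0.
apply: le_trans (ler_wpM2l B0 h) _.
have -> : B * (Q `^ sg * H `^ sg * D `^ sg) = B * H `^ sg * Q `^ sg * D `^ sg by ring.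
by apply: ler_wpM2r; first exact: powR_ge0; apply: ler_wpM2r => //; exact: powR_ge0.
Qed.

(* [B n * cyl_length w `^ sg] bounds the mass of the cylinder of a word [w] of
   length [n]; the mass of a cylinder is split between its children in
   proportion to [cyl_length `^ sg]. *)
Lemma hausdorff_measure_digits_neq0 (sg C s : K) (M : nat) (lo hi : nat -> nat)
    (B : nat -> K) (A : set K) :
  0 <= s <= sg -> 0 < sg -> (0 < M)%N ->
  (forall n, (0 < lo n <= hi n)%N) ->
  1 <= B 0%N -> (forall n, 0 < B n) ->
  (forall w, all_pos w -> B (size w) * cyl_length w `^ sg <=
     B (size w).+1 * \sum_(lo (size w) <= c < (hi (size w)).+1)
        cyl_length (rcons w c) `^ sg) ->
  (forall n, (lo n < hi n)%N -> (2 <= lo n.+1)%N \/ (hi n.+1 <= M)%N) ->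
  (forall n, (lo n < hi n)%N -> B n * ((hi n).+1%:R ^+ 2) `^ sg <= C) ->
  (forall n, exists2 m, (n <= m)%N & (lo m < hi m)%N) ->
  (forall b x, cf_expansion b x -> (forall n, (lo n <= b n <= hi n)%N) -> A x) ->
  hausdorff_measure s A <> 0%E.
Proof.
move=> /andP[s0 ssg] sg0 M0 lohi B0 Bpos HB gap HC branch HA.
have one_pow : 1 `^ sg = 1 :> K by rewrite powR1.
have lo0 n : (0 < lo n)%N by have /andP[] := lohi n.
pose S w : K := \sum_(lo (size w) <= c < (hi (size w)).+1) cyl_length (rcons w c) `^ sg.
have S0 w : all_pos w -> 0 < S w.
  move=> wp; have h := HB w wp.
  have : 0 < B (size w).+1 * S w.
    by apply: lt_le_trans h; rewrite mulr_gt0 ?powR_gt0 ?cyl_length_gt0.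
  by rewrite pmulr_rgt0.
pose p w c : K := cyl_length (rcons w c) `^ sg / S w.
have p_gt0 w c : all_pos w -> (0 < c)%N -> 0 < p w c.
  move=> wp c0; rewrite divr_gt0 ?S0 // powR_gt0 // cyl_length_gt0 //.
  by rewrite all_rcons c0.
have p_sum w : all_pos w -> \sum_(lo (size w) <= c < (hi (size w)).+1) p w c = 1.
  by move=> wp; rewrite -mulr_suml divff // gt_eqF // S0.
pose dg := greedy_digits lo hi p.
have dgP y n : 0 <= y < 1 -> (lo n <= dg y n <= hi n)%N.
  by move=> y01; apply: greedy_digits_bounds.
have dg0 y n : 0 <= y < 1 -> (0 < dg y n)%N.
  by move=> /dgP - /(_ n)/andP[+ _]; apply: leq_trans.
pose G y : K := xget 0 [set x | cf_expansion (dg y) x].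
have GP y : 0 <= y < 1 -> cf_expansion (dg y) (G y).
  move=> y01; have [x hx _] := @cf_expansion_exists K (dg y) (fun n => dg0 y n y01).
  by rewrite /G; apply: (xgetPex 0); exists x.
have mass y n : 0 <= y < 1 ->
    \prod_(i < n) p (mkseq (dg y) i) (dg y i) <= B n * cyl_length (mkseq (dg y) n) `^ sg.
  move=> y01; elim: n => [|n IH].
    by rewrite big_ord0 /cyl_length /= mulr1 invr1 powR1 mulr1.
  have wp : all_pos (mkseq (dg y) n) by apply: all_pos_mkseq => i; exact: dg0.
  rewrite big_ord_recr /= mkseqS.
  apply: le_trans (ler_wpM2r (ltW (p_gt0 _ _ wp (dg0 y n y01))) IH) _.
  have := HB _ wp; rewrite size_mkseq => h.
  rewrite /p mulrA ler_pdivrMr ?S0 //.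
  rewrite -[leRHS]mulrA [X in _ <= _ * X]mulrC mulrA ler_wpM2r ?powR_ge0 //.
  by move: h; rewrite /S size_mkseq.
have len1 w : all_pos w -> cyl_length w * (size w)%:R <= 1 :> K.
  move=> wp; rewrite /cyl_length mulrC ler_pdivrMr ?mulr_gt0 ?den_gt0 // mul1r.
  by rewrite -[leLHS]mulr1 ler_pM ?den_ge_size ?den_ge1.
have C0 : 0 < C.
  have [m _ hm] := branch 0%N; apply: lt_le_trans (HC m hm).
  by rewrite mulr_gt0 ?powR_gt0 // exprn_gt0 // ltr0n.
(* [HC] controls [B] only at branching positions, so masses are compared with cylinder lengths along
   these; there they are at most C m^(-sg), which tends to 0. *)
have same y z : 0 <= y < 1 -> 0 <= z < 1 -> dg y =1 dg z -> y = z.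
  move=> y01 z01 e; apply/eqP; rewrite -subr_eq0 -normr_eq0 eq_le normr_ge0 andbT.
  rewrite leNgt; apply/negP => yz0; set u := `|y - z| in yz0.
  have [N [N0 hN]] := exists_nat_gt ((C / u) `^ sg^-1).
  have [m Nm hm] := branch N.
  have : u <= B m * cyl_length (mkseq (dg y) m) `^ sg.
    apply: le_trans (mass y m y01).
    by apply: (@greedy_dist _ lo hi p) => // i _; exact: e.
  apply/negP; rewrite -ltNge.
  have wp : all_pos (mkseq (dg y) m) by apply: all_pos_mkseq => i; exact: dg0.
  have := len1 _ wp; rewrite size_mkseq.
  have m0 : 0 < m%:R :> K by rewrite ltr0n (leq_trans N0).
  rewrite -ler_pdivlMr // mul1r => lm.
  have BC : B m <= C.
    apply: le_trans (HC m hm); rewrite -[leLHS]mulr1 ler_wpM2l ?(ltW (Bpos m)) //.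
    rewrite -[leLHS]one_pow; apply: ge0_ler_powR; rewrite ?nnegrE ?exprn_ge0 ?(ltW sg0) //.
    by rewrite exprn_ege1 // ler1n.
  apply: (@le_lt_trans _ _ (C * (m%:R^-1) `^ sg)).
    apply: ler_pM => //; rewrite ?powR_ge0 ?(ltW (Bpos m)) //.
    apply: ge0_ler_powR => //; first exact: ltW.
      by rewrite nnegrE; exact/ltW/cyl_length_gt0.
    by rewrite nnegrE invr_ge0.
  rewrite powR_invbase ?(ltW m0) // ltr_pdivrMr ?powR_gt0 // mulrC -ltr_pdivrMr //.
  have -> : C / u = ((C / u) `^ sg^-1) `^ sg.
    by rewrite -powRrM mulVf ?gt_eqF // powRr1 // divr_ge0 // ltW.
  apply: gt0_ltr_powR; rewrite ?nnegrE ?powR_ge0 ?(ltW m0) //.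
  by apply: lt_le_trans hN _; rewrite ler_nat.
pose Q : K := 2 * (M%:R + 1).
have Q1 : 1 <= Q by have := @natr_ge1 K _ M0; rewrite /Q => ?; lra.
have Q0 : 0 < Q by lra.
have Qsg : 1 <= Q `^ sg.
  rewrite -[leLHS]one_pow; apply: ge0_ler_powR; rewrite ?nnegrE ?(ltW sg0) ?(ltW Q0) //.
apply: (@hausdorff_measure_holder_neq0 _ s (C * Q `^ sg) A G) => //.
- by rewrite mulr_gt0 // powR_gt0.
- by move=> y y01; apply: (HA (dg y)) => [|n]; [exact: GP | exact: dgP].
move=> y z y01 z01.
(* The estimate is proved with exponent [sg]; since distances are at most 1, it passes to the
   smaller exponent [s]. *)
apply: (@le_trans _ _ (C * Q `^ sg * `|G y - G z| `^ sg)); last first.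
  rewrite ler_wpM2l ?mulr_ge0 ?powR_ge0 ?(ltW C0) //.
  have [-> | dGG] := eqVneq (`|G y - G z|) 0.
    by rewrite powR0 ?gt_eqF // powR_ge0.
  have D0 : 0 < `|G y - G z| by rewrite lt_neqAle eq_sym dGG normr_ge0.
  rewrite ger_powR // D0 /=.
  apply: dist_unit_le1; apply/andP; split; apply: ltW.
  - exact: cf_expansion_gt0 (GP y y01).
  - exact: cf_expansion_lt1 (GP y y01).
  - exact: cf_expansion_gt0 (GP z z01).
  - exact: cf_expansion_lt1 (GP z z01).
have [e|/existsNP[n0 hn0]] := pselect (forall n, dg y n = dg z n).
  by rewrite (same y z y01 z01 e) subrr normr0 mulr_ge0 ?powR_ge0 // mulr_ge0 ?powR_ge0 // ltW.
have [n dn mn] := ex_minnP (ex_intro (fun n => dg y n != dg z n) n0 (introN eqP hn0)).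
have agree i : (i < n)%N -> dg y i = dg z i.
  by move=> lin; apply/eqP/negPn/negP => /mn; rewrite leqNgt lin.
(* The first disagreement can only occur at a branching position, where [gap] and [HC] apply. *)
have lh : (lo n < hi n)%N.
  have /andP[ly hy] := dgP y n y01; have /andP[lz hz] := dgP z n z01.
  rewrite ltn_neqAle (leq_trans ly hy) andbT; apply/negP => /eqP e.
  rewrite -e in hy hz; move/negP: dn; apply.
  by rewrite eqn_leq (leq_trans hy lz) (leq_trans hz ly).
have sep : cyl_length (mkseq (dg y) n) <= Q * (hi n).+1%:R ^+ 2 * `|G y - G z|.
  have [lt|lt|e] := ltngtP (dg y n) (dg z n); last by rewrite e eqxx in dn.
    apply: (expansion_separation (GP y y01) (GP z z01) agree _ M0).
      by rewrite lt; have /andP[] := dgP z n z01.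
    have /andP[ly _] := dgP y n.+1 y01; have /andP[_ hz] := dgP z n.+1 z01.
    by case: (gap n lh) => lM; [left; exact: leq_trans lM ly|right; exact: leq_trans hz lM].
  rewrite distrC; have -> : mkseq (dg y) n = mkseq (dg z) n.
    by apply/eq_in_map => i; rewrite mem_iota => /andP[_]; exact: agree.
  apply: (expansion_separation (GP z z01) (GP y y01) _ _ M0).
  - by move=> i lin; exact: esym (agree i lin).
  - by rewrite lt; have /andP[] := dgP y n y01.
  have /andP[lz _] := dgP z n.+1 z01; have /andP[_ hy] := dgP y n.+1 y01.
  by case: (gap n lh) => lM; [left; exact: leq_trans lM lz|right; exact: leq_trans hy lM].
have h1 := le_trans (@greedy_dist _ lo hi p lo0 p_gt0 p_sum y z n y01 z01 agree) (mass y n y01).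
apply: le_trans h1 _.
have wp : all_pos (mkseq (dg y) n) by apply: all_pos_mkseq => i; exact: dg0.
exact: (holder_combine (ltW sg0) (ltW Q0) (exprn_ge0 2 (ler0n _ _)) (normr_ge0 _)
  (ltW (cyl_length_gt0 wp)) (ltW (Bpos n)) sep (HC n lh)).
Qed.

End digit_restricted_sets.

(** * Regular variation *)

Section slow_variation.
Context {K : realType}.

Lemma C1_with_derivative_is_derive (c : K) (f g : K -> K) (x : K) :
  C1_with_derivative c f g -> c < x -> is_derive x 1 f (g x).
Proof.
move=> [h _] cx; have /cvgrPdist_le hx := h x (ltW cx).
have lim : h^-1 *: ((f \o shift x) (h *: 1) - f x) @[h --> 0^'] --> g x.
  apply/cvgrPdist_le => e e0.
  have [d /= d0 hd] := hx e e0.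
  exists (Num.min d (x - c)) => /=; first by rewrite lt_min d0 subr_gt0.
  move=> k /=; rewrite sub0r normrN lt_min => /andP[kd kc] k0.
  have := hd (x + k); rewrite /= opprD addrA subrr sub0r normrN => /(_ kd).
  rewrite in_itv /= andbT => /(_ _ _).
  have -> : (k *: 1 + x : K) = x + k by rewrite addrC [k *: _]mulr1.
  have -> : x + k - x = k by rewrite addrC addKr.
  rewrite [_ *: _]mulrC; apply.
    by rewrite -subr_eq0 addrC addKr.
  by have := ler_norm (- k); rewrite normrN; lra.
by split; [apply/cvg_ex; exists (g x) | exact: cvg_lim].
Qed.

(** Index 0 gives 4 x R'(x) <= R(x) for large x, so the derivative R^3 (4 x R' - R) / x^2 of R^4 / x
    is nonpositive. The exponent 4 gives R = O(x^(1/4)), hence sqrt x * R x = o(x), and fourth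
    powers also remove the square roots. *)
Lemma regularly_increasing_index0 (R : K -> K) : regularly_increasing R 0%E ->
  exists c : K, [/\ 0 < c, forall x, c <= x -> 0 < R x,
    forall x y, c <= x <= y -> R x <= R y,
    forall x y, c <= x <= y -> R y ^+ 4 * x <= R x ^+ 4 * y &
    forall M, exists X, forall x, X <= x -> M <= R x].
Proof.
move=> [c c0 [g [C1 Rpos Roo gpos /fine_cvgP[_ lim]]]].
have /cvgrPdist_le/(_ (4^-1)) := lim.
have e4 : (0 : K) < 4^-1 by rewrite invr_gt0.
move=> /(_ e4)[X [_ hX]].
pose c1 := Num.max (c + 1) (X + 1).
have c1c : c + 1 <= c1 by rewrite le_max lexx.
have c1X : X + 1 <= c1 by rewrite le_max lexx orbT.
have der x : c1 <= x -> is_derive x 1 R (g x).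
  by move=> c1x; apply: (C1_with_derivative_is_derive C1); lra.
exists c1; split.
- lra.
- by move=> x c1x; apply: Rpos; lra.
- move=> x y /andP[c1x]; rewrite le_eqVlt => /predU1P[-> //|xy].
  have [||z] := @MVT K R g x y xy.
  + by move=> z; rewrite in_itv /= => /andP[xz _]; apply: der; lra.
  + apply: derivable_within_continuous => z; rewrite in_itv /= => /andP[xz _].
    by have [] := der z (le_trans c1x xz).
  rewrite in_itv /= => /andP[xz zy] E.
  have : 0 <= g z * (y - x).
    by rewrite mulr_ge0 ?subr_ge0 ?ltW // gpos //; lra.
  lra.
- move=> x y /andP[c1x]; rewrite le_eqVlt => /predU1P[-> //|xy].
  pose h : K -> K := (R ^+ 4) * (fun t => t^-1).
  have hder z : c1 <= z -> is_derive z 1 h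
      (R z ^+ 3 / z ^+ 2 * (4 * z * g z - R z)).
    move=> c1z; have z0 : z != 0 by rewrite gt_eqF //; lra.
    have d1 := @is_deriveX _ _ _ 4 _ _ _ (der z c1z).
    have d2 := @is_deriveV _ _ _ _ _ z0 (@is_derive_id _ _ z 1).
    apply: (is_derive_eq (is_deriveM d1 d2)). 
    by rewrite /= /GRing.scale /= exprfctE; field.
  have [||z] := @MVT K h (fun z => R z ^+ 3 / z ^+ 2 * (4 * z * g z - R z)) x y xy.
  + by move=> z; rewrite in_itv /= => /andP[xz _]; apply: hder; lra.
  + apply: derivable_within_continuous => z; rewrite in_itv /= => /andP[xz _].
    by have [] := hder z (le_trans c1x xz).
  rewrite in_itv /= => /andP[xz zy] E.
  have z0 : 0 < z by lra.
  have Rz : 0 < R z by apply: Rpos; lra.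
  have gz : 4 * z * g z <= R z.
    have : `|0 - z * g z / R z| <= 4^-1 by apply: (hX z); lra.
    rewrite sub0r normrN => /(le_trans (ler_norm _)).
    rewrite ler_pdivrMr //; lra.
  have : h y <= h x.
    rewrite -subr_le0 E mulr_le0_ge0 ?subr_ge0 ?(ltW xy) //.
    by rewrite mulr_ge0_le0 ?subr_le0 // divr_ge0 ?exprn_ge0 // ltW.
  have hE t : h t = R t ^+ 4 / t by rewrite /h mulrfctE exprfctE.
  have [x0 y0] : 0 < x /\ 0 < y by split; lra.
  by rewrite !hE ler_pdivrMr // mulrAC ler_pdivlMr.
- move=> M; have [X' [_ hX']] := (cvgryPge R).1 Roo M.
  by exists (X' + 1) => x X'x; apply: hX'; lra.
Qed.

End slow_variation.

(** * The upper bound 1/2 *)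

Section products_of_consecutive_digits.
Context {K : realType}.
Implicit Types (b : nat -> nat) (x : K).

Lemma max_product_expansion b x n : cf_expansion b x ->
  max_product n x = \max_(1 <= i < n.+1) (b i.-1 * b i)%N.
Proof.
move=> bx; apply: eq_big_nat => i /andP[i0 _].
by rewrite -(prednK i0) !(cf_expansion_partial_quotient _ bx).
Qed.

Lemma max_product_no_expansion x n : ~ (exists b, cf_expansion b x) -> max_product n x = 0%N.
Proof.
move=> nx; apply: big1 => i _; rewrite /partial_quotient.
by rewrite !xgetPN // => b bx; apply: nx; exists b.
Qed.

Lemma bigmax_nat_jump (u : nat -> nat) m n : (m <= n)%N ->
  (\max_(1 <= i < m.+1) u i < \max_(1 <= i < n.+1) u i)%N ->
  exists2 i, (m < i <= n)%N & u i = \max_(1 <= j < n.+1) u j.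
Proof.
elim: n => [|n IH] mn; first by rewrite leqn0 in mn; rewrite (eqP mn) ltnn.
have [->|mn'] := eqVneq m n.+1; first by rewrite ltnn.
have mn2 : (m <= n)%N by lia.
rewrite [X in (_ < X)%N -> _]big_nat_recr //= => h.
have [le|lt] := leqP (\max_(1 <= i < n.+1) u i) (u n.+1).
  by exists n.+1; [lia | rewrite big_nat_recr //=; lia].
have [|i mi ui] := IH mn2; first by lia.
by exists i; [lia | rewrite big_nat_recr //= ui; lia].
Qed.

Lemma prod_windows_ge (v : nat -> K) (X : K) m p j : (forall i, 1 <= v i) -> 0 <= X ->
  (forall l, (l < j)%N -> exists2 i, (m + l * p < i <= m + l.+1 * p)%N & X <= v i) ->
  X ^+ j <= \prod_(m.+1 <= i < (m + j * p).+1) v i.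
Proof.
move=> v1 X0; elim: j => [|j IH] h; first by rewrite mul0n addn0 big_geq // expr0.
have prod1 (a c : nat) : 1 <= \prod_(a <= i < c) v i.
  by elim/big_ind : _ => // y z y1 z1; rewrite -[leLHS]mulr1 ler_pM.
rewrite (@big_cat_nat _ _ _ (m + j * p).+1) /=; [|lia|lia].
rewrite exprSr; apply: ler_pM; rewrite ?exprn_ge0 //.
  by apply: IH => l lj; apply: h; exact: leqW.
have [i mi Xi] := h j (ltnSn j).
rewrite (@big_cat_nat _ _ _ i) /=; [|lia|lia].
rewrite -[leLHS]mul1r; apply: ler_pM => //.
rewrite big_nat_recl; last lia.
rewrite -[leLHS]mulr1; apply: ler_pM => //.
by elim/big_ind : _ => // y z y1 z1; rewrite -[leLHS]mulr1 ler_pM.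
Qed.

(** Each digit occurs in at most two consecutive products, and extra digits only enlarge the right
    side. *)
Lemma prod_consecutive_le b m n : (forall i, (0 < b i)%N) ->
  \prod_(m.+1 <= i < n) (b i.-1 * b i)%:R <= (\prod_(c <- mkseq b n) c%:R) ^+ 2 :> K.
Proof.
move=> bp; have b1 i : 1 <= (b i)%:R :> K := natr_ge1 (bp i).
have prod1 (r : seq nat) : 1 <= \prod_(i <- r) (b i)%:R :> K.
  by elim/big_ind : _ => // y z y1 z1; rewrite -[leLHS]mulr1 ler_pM.
have sub a c : (a <= c)%N -> (c <= n)%N ->
    \prod_(a <= i < c) (b i)%:R <= \prod_(0 <= i < n) (b i)%:R :> K.
  move=> ac cn; rewrite (@big_cat_nat _ _ _ a 0 n) //=; last lia.
  rewrite (@big_cat_nat _ _ _ c a n) //=.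
  rewrite -[leLHS]mul1r; apply: ler_pM => //; first exact: prodr_ge0.
  by rewrite -[leLHS]mulr1; apply: ler_pM => //; exact: prodr_ge0.
have -> : \prod_(c <- mkseq b n) c%:R = \prod_(0 <= i < n) (b i)%:R :> K.
  by rewrite big_map /index_iota subn0.
have [nm|mn] := leqP n m.+1.
  by rewrite big_geq // exprn_ege1.
under eq_bigr do rewrite natrM.
rewrite big_split /= expr2; apply: ler_pM; rewrite ?prodr_ge0 //; last by apply: sub; lia.
case: n sub mn {prod1} => // n sub mn.
by rewrite big_add1 /=; apply: sub; lia.
Qed.

(** With A = sqrt k and B = sqrt (k + p) below 2 p, B - A = p / (A + B) >= 1/4, so the exponent
    grows by at least 16 / 4 = 4, and exp 4 >= 5. The factor 3 is the ratio of the bounds 3/2 phi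
    and phi / 2 between which the maximum lies. *)
Lemma exp_sqrt_jump (p A B r r' : K) : 0 < p -> 0 <= A -> 0 <= B ->
  B ^+ 2 = A ^+ 2 + p -> A ^+ 2 + p <= 2 * (p * p) -> 16 <= r -> r <= r' ->
  3 * expR (A * r) < expR (B * r').
Proof.
move=> p0 A0 B0 B2 kp r16 rr'.
have Bp : B <= 2 * p by rewrite -(ler_pXn2r (_ : 0 < 2)%N) ?nnegrE //; nra.
have AB : A <= B by rewrite -(ler_pXn2r (_ : 0 < 2)%N) ?nnegrE //; lra.
have BA : 4^-1 <= B - A.
  have : p = (B - A) * (B + A) by rewrite -subr_sqr B2; lra.
  by nra.
have h : A * r + 4 <= B * r' by nra.
have e5 : 5 <= expR 4 :> K by have := expR_ge1Dx (4 : K); lra.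
apply: lt_le_trans (_ : expR (A * r + 4) <= _); last by rewrite ler_expR.
by rewrite expRD; have := expR_gt0 (A * r); nra.
Qed.

(* In each window (p^2 + l p, p^2 + (l + 1) p] the maximum has to jump, so that
   some product there is of order phi; with p such windows, the product of the
   first 2 p^2 digits is at least exp (p^2 R (p^2) / 2) up to an exponential. *)
Lemma L_set_large_digit_products (R phi : K -> K) (c : K) :
  (forall x, 0 < x -> 0 < phi x) -> 0 < c ->
  (forall x, c <= x -> 0 < R x) ->
  (forall x y, c <= x <= y -> R x <= R y) ->
  (forall M, exists X, forall x, X <= x -> M <= R x) ->
  (forall n : nat, (0 < n)%N -> ln (phi n%:R) = Num.sqrt n%:R * R n%:R) ->
  forall E : K, 0 < E -> forall (N : nat) (x : K), L_set phi x -> exists w : seq nat,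
     [/\ all_pos w, (N <= size w)%N, E ^+ size w <= \prod_(c <- w) c%:R &
         exists2 t, 0 <= t <= 1 & x = cf w t].
Proof.
move=> phi0 c0 Rpos Rmono Roo lnphi E E0 N x [x01 xirr /cvg_natP lim].
have e2 : (0 : K) < 2^-1 by rewrite invr_gt0.
have [N1 hN1] := lim _ e2.
(* Without an expansion, [get] would return the zero sequence and the ratio would be 0 for all n,
   against its limit 1. *)
have [b bx] : exists b, cf_expansion b x.
  apply: contrapT => nx; have := hN1 N1 (leqnn _).
  by rewrite max_product_no_expansion // mul0r sub0r normrN normr1; lra.
have [bp _] := bx.
pose u i := (b i.-1 * b i)%N.
have Lb n : (N1 < n)%N -> phi n%:R / 2 <= (\max_(1 <= i < n.+1) u i)%:R <= 3 / 2 * phi n%:R.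
  move=> n0; have p0 : 0 < phi n%:R by apply: phi0; rewrite ltr0n (leq_ltn_trans _ n0).
  have := hN1 n (ltnW n0); rewrite (max_product_expansion n bx).
  rewrite -/u ler_norml lerBrDr lerBlDr ler_pdivlMr // ler_pdivrMr //.
  by move=> /andP[h1 h2]; apply/andP; split; lra.
pose D := Num.max 1 E.
have D1 : 1 <= D by rewrite le_max lexx.
have D0 : 0 <= D by rewrite (le_trans _ D1).
have ED : E <= D by rewrite le_max lexx orbT.
(* 16 serves the jumps. For the rest, twice the word length is 4 p^2 + 2 <= 6 p^2, so D^(6 p) <= Y
   is needed; since exp R >= 2 D^6 and Y = exp (p R) / 2, the 2 absorbs the halving in Y. *)
have [X hX] := Roo (16 + 2 * D ^+ 6).
have [p0 [p00 hp0]] := exists_nat_gt (`|X| + c).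
have [p [pgt0 N1p Np pr]] : exists p : nat,
    [/\ (0 < p)%N, (N1 < p)%N, (N <= p)%N & `|X| + c < p%:R].
  exists (p0 + N1 + N).+1; split => //.
  - by rewrite ltnS -addnA addnCA leq_addr.
  - by rewrite leqW // leq_addl.
  - by apply: lt_le_trans hp0 _; rewrite ler_nat leqW // -addnA leq_addr.
have pX : X < p%:R by have := ler_norm X; lra.
have pc : c < p%:R by have := normr_ge0 X; lra.
have ppp : (p <= p * p)%N by rewrite leq_pmulr.
have pp0 : (0 < p * p)%N by exact: leq_trans ppp.
have p1 : 1 <= p%:R :> K by rewrite ler1n.
have pp : p%:R <= (p * p)%:R :> K by rewrite natrM; nra.
have Rp : 16 + 2 * D ^+ 6 <= R (p * p)%:R by apply: hX; lra.
have D60 : 0 < D ^+ 6 by rewrite exprn_gt0; lra.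
have phiE n : (0 < n)%N -> phi n%:R = expR (Num.sqrt n%:R * R n%:R).
  by move=> n0; rewrite -lnphi // lnK // posrE phi0 // ltr0n.
have phi_mono m n : (p * p <= m)%N -> (m <= n)%N -> phi m%:R <= phi n%:R.
  move=> pm mn; have m0 := leq_trans pp0 pm.
  rewrite (phiE m m0) (phiE n (leq_trans m0 mn)).
  have mr : (p * p)%:R <= m%:R :> K by rewrite ler_nat.
  have nr : m%:R <= n%:R :> K by rewrite ler_nat.
  rewrite ler_expR; apply: ler_pM; rewrite ?sqrtr_ge0 //.
  - by apply/ltW/Rpos; lra.
  - by rewrite ler_sqrt.
  - by apply: Rmono; apply/andP; split; lra.
have phi_jump k : (p * p <= k)%N -> (k + p <= 2 * (p * p))%N ->
    3 * phi k%:R < phi (k + p)%:R.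
  move=> pk kp; have k0 : (0 < k)%N by apply: leq_trans pk.
  rewrite (phiE k k0) (phiE (k + p)%N (leq_trans k0 (leq_addr _ _))).
  have mr : (p * p)%:R <= k%:R :> K by rewrite ler_nat.
  have R1 : R (p * p)%:R <= R k%:R by apply: Rmono; apply/andP; split; lra.
  have R2 : R k%:R <= R (k + p)%:R.
    by apply: Rmono; rewrite ler_nat leq_addr andbT; lra.
  set A := Num.sqrt k%:R; set B := Num.sqrt (k + p)%:R.
  have A2 : A ^+ 2 = k%:R by rewrite sqr_sqrtr.
  have B2 : B ^+ 2 = A ^+ 2 + p%:R by rewrite A2 sqr_sqrtr // natrD.
  have kpr : A ^+ 2 + p%:R <= 2 * (p%:R * p%:R) by rewrite A2 -natrD -!natrM ler_nat.
  have p_gt0 : 0 < p%:R :> K by rewrite ltr0n.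
  have R16 : 16 <= R (p * p)%:R by apply: le_trans Rp; rewrite lerDl mulr_ge0 // ltW.
  apply: (exp_sqrt_jump p_gt0 _ _ B2 kpr _ R2); rewrite ?sqrtr_ge0 //.
  exact: le_trans R1.
set Y := phi (p * p)%:R / 2.
have Y0 : 0 < Y by rewrite divr_gt0 // phi0 // ltr0n.
have win l : (l < p)%N ->
    exists2 i, (p * p + l * p < i <= p * p + l.+1 * p)%N & Y <= (u i)%:R.
  move=> lp; set k := (p * p + l * p)%N.
  have kp : (p * p + l.+1 * p = k + p)%N by rewrite /k mulSn addnCA addnC.
  have kpp : (k + p <= 2 * (p * p))%N.
    by rewrite -kp mul2n -addnn leq_add2l leq_mul2r lp orbT.
  have pk : (p * p <= k)%N by rewrite leq_addr.
  have N1pp := leq_trans N1p ppp.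
  have /andP[_ h1] := Lb k (leq_trans N1pp pk).
  have /andP[h2 _] := Lb (k + p)%N (leq_trans N1pp (leq_trans pk (leq_addr _ _))).
  have h3 := phi_jump k pk kpp.
  have [|i ki ui] := @bigmax_nat_jump u k (k + p) (leq_addr _ _).
    by rewrite -(ltr_nat K); lra.
  exists i; first by rewrite kp.
  rewrite ui; apply: le_trans h2; rewrite ler_pM2r ?invr_gt0 //.
  exact: phi_mono (leq_trans pk (leq_addr _ _)).
have u1 i : 1 <= (u i)%:R :> K by rewrite ler1n muln_gt0 !bp.
have := prod_windows_ge u1 (ltW Y0) win.
move=> /le_trans - /(_ _ (prod_consecutive_le _ _ bp)).
set n := (p * p + p * p).+1; set W := \prod_(c <- mkseq b n) _ => hW.
exists (mkseq b n); rewrite size_mkseq; split.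
- exact: all_pos_mkseq.
- by rewrite /n leqW // (leq_trans Np) // (leq_trans ppp) // leq_addr.
- have W0 : 0 <= W by apply: prodr_ge0.
  apply: le_trans (_ : D ^+ n <= _); first by rewrite lerXn2r ?nnegrE ?(ltW E0).
  rewrite -(@ler_pXn2r _ 2) ?nnegrE ?exprn_ge0 //.
  apply: le_trans hW; rewrite -exprM.
  apply: le_trans (_ : D ^+ (6 * p * p) <= _).
    rewrite ler_weXn2l // /n; move: (pgt0); clear; nia.
  rewrite exprM lerXn2r ?nnegrE ?exprn_ge0 ?(ltW Y0) //.
  rewrite /Y ler_pdivlMr // phiE //.
  have -> : Num.sqrt (p * p)%:R = p%:R :> K by rewrite natrM -expr2 sqrtr_sqr ger0_norm.
  rewrite expRM_natl.
  apply: le_trans (_ : (2 * D ^+ 6) ^+ p <= _).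
    rewrite mulrC [leRHS]exprMn -exprM ler_wpM2r ?exprn_ge0 //.
    by rewrite -[leLHS]expr1 ler_weXn2l // ler1n.
  rewrite lerXn2r ?nnegrE ?expR_ge0 ?mulr_ge0 ?exprn_ge0 //.
  by apply: le_trans (expR_ge1Dx _); lra.
have [y [_ y01 xy]] := cf_expansion_shift n bx.
by exists y.
Qed.

End products_of_consecutive_digits.

(** * Lower bounds *)

Section cylinder_ratios.
Context {K : realType}.
Implicit Types (w : seq nat) (x : K).

Lemma cyl_length_ratio_ge w c : all_pos w -> (0 < c)%N ->
  cyl_length w / (6 * c%:R ^+ 2) <= cyl_length (rcons w c) :> K.
Proof.
move=> wp c0; have c1 := @natr_ge1 K _ c0.
have q0 := @den_gt0 K w 0 (lexx 0) wp.
have /andP[q01 q2] := @den_le K _ wp.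
have q1 : 0 < den w (1 : K) by lra.
rewrite /cyl_length -invfM den_rcons0 // den_rcons1 //.
have cq : 0 <= (c%:R - 1) * den w (0 : K) by rewrite mulr_ge0 ?(ltW q0) ?subr_ge0.
have d1 : 0 < (c%:R - 1) * den w 0 + den w (1 : K) by lra.
have d2 : 0 < c%:R * den w 0 + den w (1 : K) by lra.
have cr0 : 0 < c%:R :> K by rewrite ltr0n.
rewrite lef_pV2 ?posrE ?mulr_gt0 ?exprn_gt0 //.
move: (den w 0) (den w 1) (c%:R : K) c1 q0 q01 q2 q1 cq d1 d2 => q r C c1 q0 q01 q2 q1 cq d1 d2.
have h1 : (C - 1) * q + r <= C * r by nra.
have h2 : C * q + r <= 3 * C * q by nra.
apply: le_trans (ler_pM (ltW d1) (ltW d2) h1 h2) _.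
have : 0 <= C ^+ 2 * (q * r) by rewrite mulr_ge0 ?exprn_ge0 ?mulr_ge0 ?ltW //; lra.
by nra.
Qed.

Lemma cyl_length_ratio_le w c : all_pos w -> (0 < c)%N ->
  cyl_length (rcons w c) <= cyl_length w / 2 :> K.
Proof.
move=> wp c0; have c1 := @natr_ge1 K _ c0.
have q0 := @den_gt0 K w 0 (lexx 0) wp.
have /andP[q01 q2] := @den_le K _ wp.
have q1 : 0 < den w (1 : K) by lra.
rewrite /cyl_length -invfM den_rcons0 // den_rcons1 //.
have cq : 0 <= (c%:R - 1) * den w (0 : K) by rewrite mulr_ge0 ?(ltW q0) ?subr_ge0.
have d1 : 0 < (c%:R - 1) * den w 0 + den w (1 : K) by lra.
have d2 : 0 < c%:R * den w 0 + den w (1 : K) by lra.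
rewrite lef_pV2 ?posrE ?mulr_gt0 //.
move: (den w 0) (den w 1) (c%:R : K) c1 q0 q01 q2 q1 cq d1 d2 => q r C c1 q0 q01 q2 q1 cq d1 d2.
have h1 : r <= (C - 1) * q + r by nra.
have h2 : 2 * q <= C * q + r by nra.
have q20 : 0 <= 2 * q by lra.
have := ler_pM (ltW q1) q20 h1 h2; lra.
Qed.

(** With q = [den w 0] and r = [den w 1], the child c has length (1 / ((c-1) q + r) - 1 / (c q + r))
    / q, so the sum telescopes. The children beyond M take the fraction r / (M q + r), at most 2 /
    (M + 1) because r <= 2 q. *)
Lemma sum_cyl_length w M : all_pos w ->
  cyl_length w * (1 - 2 / (M%:R + 1)) <=
    \sum_(1 <= c < M.+1) cyl_length (rcons w c) :> K.
Proof.
move=> wp.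
have q0 := @den_gt0 K w 0 (lexx 0) wp.
have /andP[q01 q2] := @den_le K _ wp.
have q1 : 0 < den w (1 : K) by lra.
have M0 : 0 <= M%:R :> K by [].
have -> : \sum_(1 <= c < M.+1) cyl_length (rcons w c) =
    (den w 0)^-1 * ((den w 1)^-1 - (M%:R * den w 0 + den w 1)^-1) :> K.
  elim: M {M0} => [|M IH]; first by rewrite big_geq // mul0r add0r subrr mulr0.
  rewrite big_nat_recr //= IH /cyl_length den_rcons0 // den_rcons1 //.
  have m0 : 0 <= M%:R :> K by [].
  rewrite -natr1; move: (M%:R : K) m0 => m m0.
  by field; rewrite !gt_eqF //; nra.
rewrite /cyl_length.
move: (den w 0) (den w 1) (M%:R : K) M0 q0 q01 q2 q1 => q r m M0 q0 q01 q2 q1.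
have d0 : 0 < m * q + r by nra.
have -> : q^-1 * (r^-1 - (m * q + r)^-1) = (q * r)^-1 * (1 - r / (m * q + r)).
  by field; rewrite !gt_eqF.
rewrite ler_wpM2l ?invr_ge0 ?mulr_ge0 ?(ltW q0) ?(ltW q1) // lerD2l lerN2.
by rewrite ler_pdivrMr // mulrAC ler_pdivlMr; nra.
Qed.

(** Each child is at most half as long as its parent, so lowering the exponent from 1 to [sg] gains
    the factor 2^(1 - sg), which outweighs the loss 2 / (M + 1) for large M. *)
Lemma sum_cyl_length_pow (sg : K) w M : 0 < sg < 1 -> all_pos w ->
  (1 - 2 / (M%:R + 1)) * 2 `^ (1 - sg) * cyl_length w `^ sg <=
    \sum_(1 <= c < M.+1) cyl_length (rcons w c) `^ sg :> K.
Proof.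
move=> /andP[s0 s1] wp.
have l0 : 0 < cyl_length w :> K by exact: cyl_length_gt0.
have pw (a : K) : 0 < a -> a `^ sg = a * a `^ (- (1 - sg)).
  move=> a0; rewrite -[X in X * _]powRr1 ?(ltW a0) // -powR_addexp //.
  by congr powR; lra.
have z0 : 0 < 2 `^ (1 - sg) * cyl_length w `^ (- (1 - sg)) by rewrite mulr_gt0 ?powR_gt0.
apply: (@le_trans _ _ ((2 `^ (1 - sg) * cyl_length w `^ (- (1 - sg))) *
    \sum_(1 <= c < M.+1) cyl_length (rcons w c))).
  rewrite (pw _ l0).
  have := ler_wpM2l (ltW z0) (sum_cyl_length M wp); lra.
rewrite mulr_sumr; apply: ler_sum_nat => c /andP[c0 _].
have wc : all_pos (rcons w c) by rewrite all_rcons c0.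
have lc : 0 < cyl_length (rcons w c) :> K by exact: cyl_length_gt0.
rewrite (pw _ lc) [leRHS]mulrC ler_wpM2r ?(ltW lc) //.
have -> : 2 `^ (1 - sg) * cyl_length w `^ (- (1 - sg)) = ((cyl_length w / 2) `^ (1 - sg))^-1.
  rewrite powRM ?(ltW l0) ?invr_ge0 // powR_invbase // invfM invrK mulrC.
  by rewrite powRN.
rewrite powRN lef_pV2 ?posrE ?powR_gt0 ?divr_gt0 //.
apply: ge0_ler_powR; rewrite ?nnegrE ?(ltW lc) ?divr_ge0 ?(ltW l0) //; first lra.
exact: cyl_length_ratio_le.
Qed.

End cylinder_ratios.

Section limits.
Context {K : realType}.

Lemma L_set_of_digits (phi : K -> K) (b : nat -> nat) (x : K) (n0 : nat) :
  (forall x : K, 0 < x -> 0 < phi x) -> cf_expansion b x ->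
  (forall m n, (n0 <= m <= n)%N -> phi m%:R <= phi n%:R) ->
  (forall M : K, exists N, forall n, (N <= n)%N -> M <= phi n%:R) ->
  (forall e, 0 < e -> exists N, forall i, (N <= i)%N ->
     (b i.-1 * b i)%:R <= (1 + e) * phi i%:R) ->
  (forall e, 0 < e -> exists N, forall n, (N <= n)%N ->
     exists2 i, (1 <= i <= n)%N & (1 - e) * phi n%:R <= (b i.-1 * b i)%:R) ->
  L_set phi x.
Proof.
move=> phi0 bx mono phioo ub lb; split.
- by rewrite (cf_expansion_gt0 bx) (cf_expansion_lt1 bx).
- exact: cf_expansion_irrational bx.
apply/cvg_natP => e e0.
have [N1 h1] := ub e e0; have [N2 h2] := lb e e0.
(* The finitely many products before [m0], where [ub] or [mono] may fail, are bounded by their sum,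
   which phi eventually exceeds. *)
pose m0 := maxn N1 n0; pose T := (\sum_(1 <= i < m0) b i.-1 * b i)%N.
have [N3 h3] := phioo T%:R.
exists (N1 + n0 + N2 + N3).+1 => n nN.
have n_gt0 : (0 < n)%N by exact: leq_ltn_trans nN.
have p0 : 0 < phi n%:R by apply: phi0; rewrite ltr0n.
have n2 : (N2 <= n)%N by lia.
have n3 : (N3 <= n)%N by lia.
rewrite (max_product_expansion n bx); set L := (\max_(_ <= _ < _) _)%N.
rewrite ler_norml lerBrDr lerBlDr ler_pdivlMr // ler_pdivrMr //; apply/andP; split.
  have [i /andP[i1 i_n] hi] := h2 n n2.
  rewrite addrC; apply: le_trans hi _; rewrite ler_nat.
  apply: (@leq_bigmax_seq _ (index_iota 1 n.+1) xpredT (fun i => b i.-1 * b i)%N i) => //.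
  by rewrite mem_index_iota i1 ltnS.
rewrite /L big_nat; elim/big_ind : _ => [|a c a1 c1|i /andP[i1 i_n]].
- by rewrite mulr_ge0 ?(ltW p0) //; lra.
- by rewrite /maxn; case: ifP.
- have [im|mi] := ltnP i m0.
    apply: (@le_trans _ _ (phi n%:R)); last by nra.
    apply: le_trans (h3 n n3); rewrite ler_nat /T (bigD1_seq i) ?iota_uniq //=.
      exact: leq_addr.
    by rewrite mem_index_iota i1.
  apply: le_trans (h1 i _) _; first by apply: leq_trans mi; exact: leq_maxl.
  rewrite [e + 1]addrC ler_wpM2l //; first lra.
  apply: mono; rewrite (leq_trans (leq_maxr _ _) mi) /=; exact: i_n.
Qed.

End limits.

(** * Increments of the logarithm of phi under fast growth *)

Section slowly_varying_growth.
Context {K : realType}.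
Implicit Types (e M : K).
Context (R : K -> K) (c : K).
Context (c0 : 0 < c) (Rpos : forall x, c <= x -> 0 < R x)
  (Rmono : forall x y, c <= x <= y -> R x <= R y)
  (R4 : forall x y, c <= x <= y -> R y ^+ 4 * x <= R x ^+ 4 * y)
  (Roo : forall M, exists X, forall x, X <= x -> M <= R x).

Lemma slow_pow4_le : exists2 C, 0 < C & forall x, c <= x -> R x ^+ 4 <= C * x.
Proof.
have Rc := Rpos (lexx c).
exists (R c ^+ 4 / c) => [|x cx]; first by rewrite divr_gt0 // exprn_gt0.
have := R4 (introT andP (conj (lexx c) cx)).
by rewrite -ler_pdivlMr // mulrAC.
Qed.

(** A unit step multiplies sqrt x and R x by at most 1 + 1/x each, so the increment is at most 3
    sqrt x * R x / x. Its fourth power is at most 81 C / x, whence the choice of N. *)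
Lemma sqrt_mul_slow_increment e : 0 < e -> exists N : nat, forall n, (N <= n)%N ->
  Num.sqrt n.+1%:R * R n.+1%:R - Num.sqrt n%:R * R n%:R <= e.
Proof.
move=> e0; have [C C0 hC] := slow_pow4_le.
have [N [N0 hN]] := exists_nat_gt (c + 81 * C / e ^+ 4).
have e40 : 0 < e ^+ 4 by rewrite exprn_gt0.
have C40 : 0 < 81 * C / e ^+ 4 by rewrite divr_gt0 // mulr_gt0.
exists N => n Nn; have Nnr : N%:R <= n%:R :> K by rewrite ler_nat.
have nc : c <= n%:R.
  by apply: le_trans Nnr; apply/ltW/(le_lt_trans _ hN); rewrite lerDl ltW.
have nC : 81 * C / e ^+ 4 <= n%:R.
  by apply: le_trans Nnr; apply/ltW/(le_lt_trans _ hN); rewrite lerDr ltW.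
have n0 : 0 < n%:R :> K by lra.
have n1 : 1 <= n%:R :> K by rewrite ler1n (leq_trans N0).
rewrite -natr1; move: (n%:R : K) nc nC n0 n1 => x nc nC x0 x1 {hN Nnr Nn}.
have r0 := Rpos nc.
have r'0 : 0 < R (x + 1) by apply: Rpos; lra.
have q1 : 1 <= 1 + x^-1 by rewrite lerDl invr_ge0 ltW.
have q0 : 0 <= 1 + x^-1 by rewrite (le_trans _ q1).
have x10 : 0 <= x + 1 by lra.
have rr : R (x + 1) <= R x * (1 + x^-1).
  rewrite -(@ler_pXn2r _ 4) ?nnegrE ?mulr_ge0 ?(ltW r0) ?(ltW r'0) //.
  rewrite exprMn; apply: (@le_trans _ _ (R x ^+ 4 * (1 + x^-1))).
    have -> : R x ^+ 4 * (1 + x^-1) = R x ^+ 4 * (x + 1) / x by field; rewrite gt_eqF.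
    by rewrite ler_pdivlMr //; apply: R4; apply/andP; split; lra.
  by rewrite ler_wpM2l ?exprn_ge0 ?(ltW r0) // ler_eXnr.
have ss : Num.sqrt (x + 1) <= Num.sqrt x * (1 + x^-1).
  rewrite -(@ler_pXn2r _ 2) ?nnegrE ?mulr_ge0 ?sqrtr_ge0 //.
  rewrite exprMn !sqr_sqrtr ?(ltW x0) //.
  apply: (@le_trans _ _ (x * (1 + x^-1))).
    by rewrite mulrDr mulfV ?gt_eqF // mulr1.
  by rewrite ler_wpM2l ?(ltW x0) // ler_eXnr.
have s0 := sqrtr_ge0 x.
have prod := ler_pM (sqrtr_ge0 (x + 1)) (ltW r'0) ss rr.
have xV1 : x^-1 <= 1 by rewrite invf_le1.
have bnd : 3 * (Num.sqrt x * R x) <= e * x.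
  rewrite -(@ler_pXn2r _ 4) ?nnegrE ?mulr_ge0 ?(ltW r0) ?(ltW e0) ?(ltW x0) //.
  rewrite !exprMn; have -> : Num.sqrt x ^+ 4 = x ^+ 2.
    by rewrite (exprM _ 2 2) sqr_sqrtr // ltW.
  have := hC _ nc; move: nC; rewrite ler_pdivrMr // => nC hRx.
  have x20 : 0 <= 81 * x ^+ 2 by rewrite mulr_ge0 // exprn_ge0 // ltW.
  have x30 : 0 <= x ^+ 3 by rewrite exprn_ge0 // ltW.
  have := ler_wpM2l x20 hRx; have := ler_wpM2l x30 nC.
  have -> : 3 ^+ 4 = 81 :> K by ring.
  by lra.
have : 3 * (Num.sqrt x * R x) / x <= e by rewrite ler_pdivrMr.
set P := Num.sqrt x * R x.
have P0 : 0 <= P by rewrite mulr_ge0 // ltW.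
have : Num.sqrt x * (1 + x^-1) * (R x * (1 + x^-1)) <= P + 3 * P / x.
  have -> : Num.sqrt x * (1 + x^-1) * (R x * (1 + x^-1)) = P + P * (2 * x^-1 + x^-1 * x^-1).
    by rewrite /P; ring.
  have xi0 : 0 <= x^-1 by rewrite invr_ge0 ltW.
  have : 0 <= P * (x^-1 * (1 - x^-1)) by apply: mulr_ge0 => //; apply: mulr_ge0 => //; rewrite subr_ge0.
  by move: (x^-1) => i; lra.
lra.
Qed.

End slowly_varying_growth.

Section cylinder_powers.
Context {K : realType}.

Lemma cyl_length_pow_ratio (sg H : K) (w : seq nat) (c : nat) : 0 <= sg ->
  all_pos w -> (0 < c)%N -> c%:R <= H ->
  cyl_length w `^ sg <= (6 * H ^+ 2) `^ sg * cyl_length (rcons w c) `^ sg.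
Proof.
move=> s0 wp c0 cH.
have cr : 0 < c%:R :> K by rewrite ltr0n.
have H0 : 0 <= H by apply: le_trans cH.
have wc : all_pos (rcons w c) by rewrite all_rcons c0.
have l1 := @cyl_length_gt0 K _ wp; have l2 := @cyl_length_gt0 K _ wc.
rewrite -powRM ?mulr_ge0 ?exprn_ge0 ?(ltW l2) //.
apply: ge0_ler_powR; rewrite ?nnegrE ?mulr_ge0 ?exprn_ge0 ?(ltW l1) ?(ltW l2) //.
have := @cyl_length_ratio_ge K w c wp c0.
rewrite ler_pdivrMr ?mulr_gt0 ?exprn_gt0 // mulrC => /le_trans; apply.
by rewrite ler_wpM2r ?(ltW l2) // ler_wpM2l // lerXn2r ?nnegrE ?(ltW cr).
Qed.

End cylinder_powers.

(** * Lower bound 1/2 under fast growth *)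

Section fast_growth.
Context {K : realType}.
Implicit Types (e M : K).
Context (R phi : K -> K) (c : K).
Context (phi0 : forall x, 0 < x -> 0 < phi x)
  (c0 : 0 < c) (Rpos : forall x, c <= x -> 0 < R x)
  (Rmono : forall x y, c <= x <= y -> R x <= R y)
  (R4 : forall x y, c <= x <= y -> R y ^+ 4 * x <= R x ^+ 4 * y)
  (Roo : forall M, exists X, forall x, X <= x -> M <= R x)
  (lnphi : forall n : nat, (0 < n)%N -> ln (phi n%:R) = Num.sqrt n%:R * R n%:R).

(** The square root of phi (n + 1): digit n has number n + 1, and the product of digits n and n + 1
    is compared with phi (n + 1). *)
Definition root_phi (n : nat) : K := expR (Num.sqrt n.+1%:R * R n.+1%:R / 2).

Local Notation T := root_phi.

Lemma root_phi_gt0 n : 0 < T n. Proof. exact: expR_gt0. Qed.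

Lemma root_phi_sqr n : phi n.+1%:R = T n ^+ 2.
Proof.
rewrite -expRM_natl -[LHS]lnK ?posrE ?phi0 ?ltr0n // lnphi //.
by congr expR; field.
Qed.

Lemma root_phi_large_R M : exists N : nat, forall n, (N <= n)%N ->
  c <= n.+1%:R /\ M <= R n.+1%:R.
Proof.
have [X hX] := Roo M; have [N [N0 hN]] := exists_nat_gt (`|X| + c).
exists N => n Nn; have Nn' : N%:R <= n.+1%:R :> K by rewrite ler_nat leqW.
have X1 := ler_norm X; have X0 := normr_ge0 X.
move: (n.+1%:R : K) Nn' c0 => x Nx c_gt0; split; [lra | apply: hX; lra].
Qed.

Lemma root_phi_unbounded M : exists N : nat, forall n, (N <= n)%N -> M <= T n.
Proof.
have [N hN] := root_phi_large_R (2 * `|M|).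
exists N => n /hN[cn Mn]; apply: le_trans (expR_ge1Dx _).
have s1 : 1 <= Num.sqrt n.+1%:R :> K by rewrite -[leLHS]sqrtr1 ler_sqrt // ler1n.
have R0 := Rpos cn; have := ler_norm M.
have : 0 <= (Num.sqrt n.+1%:R - 1) * R n.+1%:R by rewrite mulr_ge0 ?subr_ge0 ?(ltW R0).
by lra.
Qed.

Lemma root_phi_mono : exists N : nat, forall n, (N <= n)%N -> T n <= T n.+1.
Proof.
have [N hN] := root_phi_large_R 0; exists N => n /hN[cn _].
rewrite ler_expR ler_pM2r ?invr_gt0 //; apply: ler_pM; rewrite ?sqrtr_ge0 ?(ltW (Rpos cn)) //.
  by rewrite ler_sqrt // ler_nat.
by apply: Rmono; rewrite cn ler_nat leqnSn.
Qed.

Lemma root_phi_ratio e : 0 < e -> exists N : nat, forall n, (N <= n)%N ->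
  T n.+1 <= (1 + e) * T n.
Proof.
move=> e0; have l0 : 0 < 2 * ln (1 + e) by rewrite mulr_gt0 // ln_gt0 // ltrDl.
have [N hN] := sqrt_mul_slow_increment c0 Rpos R4 l0.
exists N => n Nn; have h := hN n.+1 (leqW Nn).
have -> : 1 + e = expR (ln (1 + e)) by rewrite lnK // posrE addr_gt0.
by rewrite -expRD ler_expR; lra.
Qed.

(** T^a outgrows n since log T is at least a large multiple of sqrt n. The constant is 108 = 2 * 54,
    where 54 = 6 * 3^2 is the cylinder ratio constant for digits up to 3 T and 2 allows for T
    doubling in one step. R >= 44 / a yields T^a >= 11^2 (n + 1). *)
Lemma root_phi_superpoly (a : K) : 0 < a -> exists N : nat, forall n, (N <= n)%N ->
  108 * n.+1%:R * T n `^ (1 - a) <= T n.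
Proof.
move=> a0; have [N hN] := root_phi_large_R (44 / a).
exists N => n /hN[cn]; rewrite ler_pdivrMr // => Ra.
have T0 := root_phi_gt0 n.
have TE : T n `^ a * T n `^ (1 - a) = T n.
  by rewrite -powR_addexp // (_ : a + (1 - a) = 1) ?powRr1 ?(ltW T0) //; ring.
rewrite -[leRHS]TE ler_wpM2r ?powR_ge0 //.
have -> : T n `^ a = expR (Num.sqrt n.+1%:R * R n.+1%:R * a / 4) ^+ 2.
  by rewrite /T -expRM_natl /powR gt_eqF ?expR_gt0 // expRK; congr expR; field.
have s0 : 0 <= Num.sqrt n.+1%:R :> K by exact: sqrtr_ge0.
set z := Num.sqrt n.+1%:R * R n.+1%:R * a / 4.
have z11 : Num.sqrt n.+1%:R * 11 <= z.
  by rewrite /z -!mulrA ler_wpM2l // mulrA; lra.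
have z0 : 0 <= Num.sqrt n.+1%:R * 11 :> K by rewrite mulr_ge0.
have ez : Num.sqrt n.+1%:R * 11 <= expR z by have := expR_ge1Dx z; lra.
apply: (@le_trans _ _ ((Num.sqrt n.+1%:R * 11) ^+ 2)).
  by rewrite exprMn sqr_sqrtr // mulrC ler_wpM2l //; lra.
by rewrite lerXn2r ?nnegrE ?expR_ge0.
Qed.

Lemma L_set_fast_growth_neq0 (s : K) : 0 <= s < 2^-1 ->
  hausdorff_measure s (L_set phi) <> 0%E.
Proof.
move=> /andP[s0 s1]; pose sg : K := (s + 2^-1) / 2.
have [sg0 sg1 ssg] : [/\ 0 < sg, 2 * sg < 1 & s <= sg] by rewrite /sg; split; lra.
clearbody sg; have sg_lt1 : sg < 1 by lra.
have a0 : 0 < 1 - 2 * sg by lra.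
have [N1 h1] := root_phi_unbounded 1.
have [N2 h2] := root_phi_mono.
have [N3 h3] := root_phi_ratio ltr01.
have [N4 h4] := root_phi_superpoly a0.
pose n0 := (N1 + N2 + N3 + N4)%N.
have Tge1 n : (n0 <= n)%N -> 1 <= T n by move=> nn; apply: h1; move: nn; rewrite /n0; clear; lia.
have Tmono n : (n0 <= n)%N -> T n <= T n.+1 by move=> nn; apply: h2; move: nn; rewrite /n0; clear; lia.
have Tdouble n : (n0 <= n)%N -> T n.+1 <= 2 * T n.
  by move=> nn; apply: h3; move: nn; rewrite /n0; clear; lia.
have Tpoly n : (n0 <= n)%N -> 108 * n.+1%:R * T n `^ (2 * sg) <= T n.
  move=> nn; have -> : 2 * sg = 1 - (1 - 2 * sg) by ring.
  by apply: h4; move: nn; rewrite /n0; clear; lia.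
clearbody n0; clear N1 N2 N3 N4 h1 h2 h3 h4.
have T0 n : 0 < T n := root_phi_gt0 n.
(* The width of the digit range is o(T n), so the products stay asymptotic to phi, yet it is large
   enough for T^(1 - 2 sg) / n to be unbounded. *)
pose tr n := Num.truncn (T n / n.+1%:R).
(* All digits are at least 2, which is the first alternative of the gap condition. *)
pose lo n := if (n < n0)%N then 2%N else (Num.truncn (T n)).+1.
pose hi n := if (n < n0)%N then 2%N else ((Num.truncn (T n)).+1 + tr n)%N.
(* Each initial digit 2 costs at most (6 * 2^2)^sg. From [n0] on, B decays like 1 / T n, which keeps
   B n * (hi n)^(2 sg) bounded; this decay is allowed because the children sum to at least twice the
   parent while T at most doubles. *)
pose B n : K := (24 `^ sg) ^+ minn n n0 * (T n0 / T (maxn n n0)).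
have p24 : 1 <= 24 `^ sg :> K.
  have one_pow : 1 `^ sg = 1 :> K by rewrite powR1.
  by rewrite -[leLHS]one_pow; apply: ge0_ler_powR; rewrite ?nnegrE ?(ltW sg0) // ler1n.
have Bgt0 n : 0 < B n.
  by rewrite mulr_gt0 ?divr_gt0 ?T0 // exprn_gt0 // (lt_le_trans _ p24).
have lo_ge2 n : (2 <= lo n)%N.
  rewrite /lo; case: (ltnP n n0) => // nn.
  have t0 : (0 < Num.truncn (T n))%N by rewrite truncn_gt0 Tge1.
  exact: t0.
have lohi n : (lo n <= hi n)%N by rewrite /lo /hi; case: ifP => // _; rewrite leq_addr.
have branch n : (lo n < hi n)%N -> (n0 <= n)%N.
  by rewrite /lo /hi; case: (ltnP n n0) => //; rewrite ltnn.
have lo_gt n : (n0 <= n)%N -> T n < (lo n)%:R.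
  move=> nn; rewrite /lo ltnNge nn /=.
  by have /andP[] := truncn_itv (ltW (T0 n)).
pose q n : K := T n / n.+1%:R.
have q0 n : 0 <= q n by rewrite divr_ge0 // ltW.
have qT n : q n <= T n.
  by rewrite ler_pdivrMr // -[leLHS]mulr1 ler_wpM2l ?(ltW (T0 n)) // ler1n.
have hi_le n : (n0 <= n)%N -> (hi n)%:R <= T n + 1 + q n.
  move=> nn; rewrite /hi ltnNge nn /= natrD -[(Num.truncn _).+1%:R]natr1.
  have /andP[h _] := truncn_itv (ltW (T0 n)).
  have /andP[h' _] := truncn_itv (q0 n).
  by apply: lerD => //; rewrite lerD2r.
have hi_le3 n : (n0 <= n)%N -> (hi n)%:R <= 3 * T n.
  move=> nn; apply: le_trans (hi_le n nn) _; have h1 := Tge1 n nn; have h2 := qT n.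
  by clearbody q; lra.
have Tle m n : (n0 <= m)%N -> (m <= n)%N -> T m <= T n.
  move=> nm; elim: n => [|n IH]; first by rewrite leqn0 => /eqP ->.
  rewrite leq_eqVlt => /predU1P[-> //|mn]; apply: le_trans (IH mn) _.
  by apply: Tmono; exact: leq_trans nm mn.
have pow_le n : (n0 <= n)%N -> (4 * T n) `^ (2 * sg) <= 4 * T n.
  move=> nn; rewrite -[leRHS]powRr1; last by rewrite mulr_ge0 // ltW.
  by apply: ler_powR; [have := Tge1 n nn; lra | exact: ltW].
apply: (@hausdorff_measure_digits_neq0 K sg ((24 `^ sg) ^+ n0 * T n0 * 4) s 1 lo hi B).
- by rewrite s0 ssg.
- exact: sg0.
- by [].
- by move=> n; rewrite (leq_trans _ (lo_ge2 n)) // lohi.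
- by rewrite /B min0n max0n expr0 divff ?mulr1 // gt_eqF.
- exact: Bgt0.
- move=> w wp; set n := size w.
  have L0 : 0 < cyl_length w `^ sg by rewrite powR_gt0 // cyl_length_gt0.
  have [nn|nn] := ltnP n n0.
    have -> : B n.+1 = 24 `^ sg * B n.
      rewrite /B (minn_idPl nn) (minn_idPl (ltnW nn)) (maxn_idPr nn) (maxn_idPr (ltnW nn)).
      by rewrite exprS -mulrA.
    rewrite /lo /hi nn big_nat1 mulrC mulrAC ler_wpM2r ?(ltW (Bgt0 n)) //.
    have -> : 24 = 6 * 2 ^+ 2 :> K by ring.
    exact: cyl_length_pow_ratio (ltW sg0) wp _ _.
  rewrite /B (minn_idPr nn) (minn_idPr (leqW nn)) (maxn_idPl nn) (maxn_idPl (leqW nn)).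
  rewrite -!mulrA; apply: ler_wpM2l; first by rewrite exprn_ge0 // (le_trans _ p24).
  apply: ler_wpM2l; first exact/ltW/T0.
  set L := cyl_length w `^ sg in L0 *; set S := \sum_(_ <= _ < _) _.
  suff key : 2 * L <= S.
    have -> : (T n)^-1 * L = (2 * T n)^-1 * (2 * L) by field; rewrite gt_eqF ?T0.
    apply: ler_pM => //; rewrite ?invr_ge0 ?mulr_ge0 ?(ltW (T0 n)) ?(ltW L0) //.
    by rewrite lef_pV2 ?posrE ?mulr_gt0 ?T0 // Tdouble.
  set t := T n `^ (2 * sg); have t0 : 0 < t by rewrite powR_gt0 ?T0.
  have child k : (lo n <= k < (hi n).+1)%N -> L / (54 * t) <= cyl_length (rcons w k) `^ sg.
    move=> /andP[lk hk]; have k1 : (0 < k)%N by apply: leq_trans lk; exact: ltnW (lo_ge2 n).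
    have kH : k%:R <= 3 * T n by apply: le_trans (hi_le3 n nn); rewrite ler_nat -ltnS.
    rewrite ler_pdivrMr ?mulr_gt0 // mulrC.
    apply: le_trans (cyl_length_pow_ratio (ltW sg0) wp k1 kH) _.
    rewrite ler_wpM2r ?powR_ge0 //.
    have -> : 6 * (3 * T n) ^+ 2 = 54 * T n ^+ 2 by ring.
    rewrite powRM ?exprn_ge0 ?(ltW (T0 n)) // -[T n ^+ 2]powR_mulrn ?(ltW (T0 n)) // -powRrM.
    rewrite ler_wpM2r ?powR_ge0 // -[leRHS]powRr1 //.
    by apply: ler_powR; [rewrite ler1n | exact: ltW].
  apply: (@le_trans _ _ (\sum_(lo n <= k < (hi n).+1) L / (54 * t))); last first.
    exact: ler_sum_nat.
  have -> : \sum_(lo n <= k < (hi n).+1) L / (54 * t) = (tr n).+1%:R * (L / (54 * t)).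
    have -> : (tr n).+1 = ((hi n).+1 - lo n)%N by rewrite /lo /hi ltnNge nn /= -addnS addKn.
    by rewrite big_const_nat iter_addr_0 -[LHS]mulr_natl.
  apply: (@le_trans _ _ (q n * (L / (54 * t)))); last first.
    rewrite ler_wpM2r ?divr_ge0 ?mulr_ge0 ?(ltW L0) ?(ltW t0) //.
    by have /andP[_ /ltW] := truncn_itv (q0 n).
  have := Tpoly n nn; rewrite -/t => Tp.
  have -> : q n * (L / (54 * t)) = T n / (n.+1%:R * (54 * t)) * L.
    by rewrite /q [(n.+1%:R * _)^-1]invfM; ring.
  rewrite ler_wpM2r ?(ltW L0) // ler_pdivlMr ?mulr_gt0 ?ltr0n //.
  by move: Tp; move: (n.+1%:R : K) => m; lra.
- by move=> n _; left; exact: lo_ge2.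
- move=> n /branch nn; rewrite -powR_mulrn ?ler0n // -powRrM.
  have h1 : (hi n).+1%:R `^ (2 * sg) <= 4 * T n.
    apply: le_trans (pow_le n nn).
    apply: ge0_ler_powR; rewrite ?nnegrE ?mulr_ge0 ?(ltW sg0) ?(ltW (T0 n)) //.
    have H1 := hi_le3 n nn; have H2 := Tge1 n nn.
    rewrite -natr1; apply: le_trans (lerD H1 H2) _; lra.
  apply: le_trans (ler_wpM2l (ltW (Bgt0 n)) h1) _.
  rewrite /B (minn_idPr nn) (maxn_idPl nn).
  rewrite le_eqVlt; apply/orP; left; apply/eqP; move: (24 `^ sg ^+ n0) (T n0) => p1 p2.
  by field; rewrite gt_eqF ?T0.
- move=> n; exists (maxn n n0); first exact: leq_maxl.
  have nn : (n0 <= maxn n n0)%N by exact: leq_maxr.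
  have nnF : (maxn n n0 < n0)%N = false by rewrite ltnNge nn.
  rewrite /lo /hi nnF -[X in (X < _)%N]addn0 ltn_add2l /tr truncn_gt0.
  rewrite ler_pdivlMr // mul1r; apply: le_trans (Tpoly _ nn).
  have one_pow : 1 `^ (2 * sg) = 1 :> K by rewrite powR1.
  have : 1 <= T (maxn n n0) `^ (2 * sg).
    rewrite -[leLHS]one_pow; apply: ge0_ler_powR; rewrite ?nnegrE ?mulr_ge0 ?(ltW sg0) ?(ltW (T0 _)) //.
    exact: Tge1.
  move: (T (maxn n n0) `^ (2 * sg)) => t t1.
  have : 0 < (maxn n n0).+1%:R :> K by rewrite ltr0n.
  by move: ((maxn n n0).+1%:R : K) => m m0; nra.
move=> b x bx bd; apply: (@L_set_of_digits K phi b x n0.+1) => //.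
- move=> [|m] [|n] /andP[nm mn] //; rewrite !root_phi_sqr.
  by rewrite lerXn2r ?nnegrE ?(ltW (T0 _)) // Tle.
- move=> M; have [N hN] := root_phi_unbounded M; exists (N + n0).+1 => -[|n] // nn.
  have n0n : (n0 <= n)%N by move: nn; clear; lia.
  have Nn : (N <= n)%N by move: nn; clear; lia.
  rewrite root_phi_sqr; apply: le_trans (hN n Nn) _.
  by rewrite expr2 -[leLHS]mul1r ler_wpM2r ?(ltW (T0 n)) // Tge1.
(* Two factors 1 + d come from the digits and one from the ratio of T at n + 1 and n; (1 + d)^3 <= 1
   + 7 d for d <= 1. *)
- move=> e e0; pose d := Num.min 1 (e / 7).
  have d0 : 0 < d by rewrite lt_min ltr01 divr_gt0.
  have d1 : d <= 1 by rewrite ge_min lexx.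
  have de : 7 * d <= e by rewrite mulrC -ler_pdivlMr // ge_min lexx orbT.
  have [N1 h1] := root_phi_unbounded (2 / d).
  have [N2 [_ h2]] := exists_nat_gt (2 / d).
  have [N3 h3] := root_phi_ratio d0.
  exists (N1 + N2 + N3 + n0).+1 => -[|n] //= nn.
  have hiT m : (n <= m)%N -> (b m)%:R <= (1 + d) * T m.
    move=> nm; have n0m : (n0 <= m)%N by move: nn nm; clear; lia.
    have N1m : (N1 <= m)%N by move: nn nm; clear; lia.
    have N2m : (N2 <= m.+1)%N by move: nn nm; clear; lia.
    have /andP[_ bm] := bd m.
    apply: (@le_trans _ _ (hi m)%:R); first by rewrite ler_nat.
    apply: le_trans (hi_le m n0m) _.
    have g1 : 1 <= T m * d / 2.
      by have := h1 m N1m; rewrite ler_pdivrMr //; lra.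
    have g2 : q m <= T m * d / 2.
      rewrite /q -mulrA ler_wpM2l ?(ltW (T0 m)) //.
      rewrite -[d / 2]invrK lef_pV2 ?posrE ?invr_gt0 ?divr_gt0 ?ltr0n // invf_div.
      by apply: ltW (lt_le_trans h2 _); rewrite ler_nat.
    by clearbody q; lra.
  rewrite root_phi_sqr natrM.
  have N3n : (N3 <= n)%N by move: nn; clear; lia.
  have t0 := T0 n.
  have b1 := hiT n (leqnn n).
  have b2 : (b n.+1)%:R <= (1 + d) * ((1 + d) * T n).
    apply: le_trans (hiT n.+1 (leqnSn n)) _.
    by apply: ler_wpM2l; [lra | exact: h3].
  apply: le_trans (ler_pM _ _ b1 b2) _ => //.
  have -> : (1 + d) * T n * ((1 + d) * ((1 + d) * T n)) = (1 + d) ^+ 3 * T n ^+ 2 by ring.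
  rewrite ler_wpM2r ?exprn_ge0 ?(ltW t0) //.
  have dd : d ^+ 2 <= d by rewrite expr2 -[leRHS]mulr1 ler_wpM2l // ltW.
  have ddd : d ^+ 3 <= d ^+ 2 by rewrite exprS -[leRHS]mul1r ler_wpM2r // exprn_ge0 // ltW.
  have -> : (1 + d) ^+ 3 = 1 + 3 * d + 3 * d ^+ 2 + d ^+ 3 by ring.
  lra.
move=> e e0; exists n0.+2 => -[|n] // nn; have n0n : (n0 <= n)%N by exact: ltnW.
exists n.+1 => //=; rewrite root_phi_sqr natrM.
have tb m : (n0 <= m)%N -> T m <= (b m)%:R.
  move=> nm; apply: le_trans (ltW (lo_gt m nm)) _; rewrite ler_nat.
  by have /andP[] := bd m.
apply: (@le_trans _ _ (T n ^+ 2)).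
  by rewrite ler_piMl ?exprn_ge0 ?(ltW (T0 n)) // gerBl ltW.
rewrite expr2; apply: ler_pM; rewrite ?(ltW (T0 n)) ?tb //.
by apply: le_trans (Tmono n n0n) _; apply: tb; exact: leqW.
Qed.

End fast_growth.

(** * Positions at perfect squares *)

Section sparse_squares.

Definition square_from (k0 i : nat) : bool :=
  [exists k : 'I_i.+1, (k0 <= k)%N && (i == k * k)%N].

Lemma square_fromP k0 i :
  reflect (exists2 k, (k0 <= k)%N & i = (k * k)%N) (square_from k0 i).
Proof.
apply: (iffP existsP) => [[k /andP[k0k /eqP ik]]|[k k0k ik]]; first by exists k.
have ki : (k < i.+1)%N by rewrite ik; nia.
by exists (Ordinal ki); apply/andP; split => //=; apply/eqP.
Qed.

Lemma square_from_gap k0 k i : (k * k < i < k.+1 * k.+1)%N -> ~~ square_from k0 i.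
Proof.
move=> /andP[ki ik]; apply/square_fromP => -[l _ il]; rewrite il in ki ik.
have [lk|kl] := leqP l k; first by rewrite ltnNge leq_mul in ki.
by rewrite ltnNge leq_mul in ik.
Qed.

Lemma square_from_lt k0 i : (i < k0 * k0)%N -> ~~ square_from k0 i.
Proof.
move=> h; apply/square_fromP => -[l k0l il]; rewrite il in h.
by rewrite ltnNge leq_mul in h.
Qed.

Lemma nat_sqrt_exists n : exists k, (k * k <= n < k.+1 * k.+1)%N.
Proof.
elim: n => [|n [k hk]]; first by exists 0%N.
have [h|h] := ltnP n.+1 (k.+1 * k.+1); first by exists k; lia.
by exists k.+1; nia.
Qed.

End sparse_squares.

(** * Regularity of phi under slow growth *)

Section slow_growth.
Context {K : realType}.
Implicit Types (e M : K).
Context (R phi : K -> K) (c : K).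
Context (phi0 : forall x, 0 < x -> 0 < phi x)
  (Rpos0 : forall x, 0 < x -> 0 < R x)
  (c0 : 0 < c)
  (Rmono : forall x y, c <= x <= y -> R x <= R y)
  (R4 : forall x y, c <= x <= y -> R y ^+ 4 * x <= R x ^+ 4 * y)
  (Roo : forall M, exists X, forall x, X <= x -> M <= R x)
  (lnphi : forall n : nat, (0 < n)%N -> ln (phi n%:R) = Num.sqrt n%:R / R n%:R).

Local Notation h x := (Num.sqrt x / R x).

Lemma slow_phiE n : (0 < n)%N -> phi n%:R = expR (h n%:R).
Proof. by move=> n0; rewrite -lnphi // lnK // posrE phi0 // ltr0n. Qed.

Lemma slow_phi_ge1 n : (0 < n)%N -> 1 <= phi n%:R.
Proof.
move=> n0; have nr : 0 < n%:R :> K by rewrite ltr0n.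
rewrite slow_phiE //; apply: le_trans (expR_ge1Dx _).
by rewrite lerDl divr_ge0 ?sqrtr_ge0 // ltW // Rpos0.
Qed.

Lemma sqrt_pow4 (x : K) : 0 <= x -> Num.sqrt x ^+ 4 = x ^+ 2.
Proof. by move=> x0; rewrite (exprM _ 2 2) sqr_sqrtr. Qed.

(** The fourth power of sqrt x / R x is x * (x / R^4), a product of two nondecreasing functions. *)
Lemma sqrt_div_slow_mono x y : c <= x <= y -> h x <= h y.
Proof.
move=> cxy; have /andP[cx xy] := cxy; have x0 := lt_le_trans c0 cx.
have y0 := lt_le_trans x0 xy; have Rx := Rpos0 x0; have Ry := Rpos0 y0.
rewrite ler_pdivrMr // mulrAC ler_pdivlMr //.
rewrite -(@ler_pXn2r _ 4) ?nnegrE ?mulr_ge0 ?sqrtr_ge0 ?(ltW Rx) ?(ltW Ry) //.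
rewrite !exprMn !sqrt_pow4 ?(ltW x0) ?(ltW y0) //.
have h1 := ler_wpM2l (ltW x0) (R4 cxy).
have h2 : x * (R x ^+ 4 * y) <= y ^+ 2 * R x ^+ 4.
  have -> : y ^+ 2 * R x ^+ 4 = y * (R x ^+ 4 * y) by ring.
  by rewrite ler_wpM2r // mulr_ge0 ?exprn_ge0 // ltW.
apply: le_trans h2; apply: le_trans h1; rewrite le_eqVlt; apply/orP; left.
by apply/eqP; ring.
Qed.

(** The increment is at most 1 / R m. Thus phi is nearly constant between consecutive squares, and a
    large digit at k^2 serves all n below (k + 1)^2. *)
Lemma sqrt_div_slow_increment e : 0 < e -> exists N : nat, forall m n, (N <= m)%N ->
  (m <= n)%N -> Num.sqrt n%:R <= Num.sqrt m%:R + 1 :> K -> h n%:R - h m%:R <= e.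
Proof.
move=> e0; have [X hX] := Roo e^-1; have [N [_ hN]] := exists_nat_gt (`|X| + c).
exists N => m n Nm mn sq.
have X1 := ler_norm X; have X0 := normr_ge0 X.
have Nr : N%:R <= m%:R :> K by rewrite ler_nat.
have mr : m%:R <= n%:R :> K by rewrite ler_nat.
have c_gt0 := c0.
have cm : c <= m%:R by lra.
have Rm : e^-1 <= R m%:R by apply: hX; lra.
have Rmn : R m%:R <= R n%:R by apply: Rmono; rewrite cm.
have Rm0 : 0 < R m%:R by apply: Rpos0; lra.
have Rn0 : 0 < R n%:R by apply: lt_le_trans Rmn.
apply: (@le_trans _ _ (Num.sqrt n%:R / R m%:R - h m%:R)).
  by rewrite lerD2r ler_wpM2l ?sqrtr_ge0 // lef_pV2.
rewrite -mulrBl ler_pdivrMr //.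
apply: (@le_trans _ _ 1); first by rewrite lerBlDl.
by rewrite -ler_pdivrMl // mulr1.
Qed.

Lemma slow_phi_ratio e : 0 < e -> exists N : nat, forall m n, (N <= m)%N ->
  (m <= n)%N -> Num.sqrt n%:R <= Num.sqrt m%:R + 1 :> K ->
  phi n%:R <= (1 + e) * phi m%:R.
Proof.
move=> e0; have l0 : 0 < ln (1 + e) by rewrite ln_gt0 // ltrDl.
have [N hN] := sqrt_div_slow_increment l0; exists N.+1 => m n Nm mn sq.
have m0 : (0 < m)%N by exact: leq_trans Nm.
rewrite (slow_phiE m0) (slow_phiE (leq_trans m0 mn)).
have -> : 1 + e = expR (ln (1 + e)) by rewrite lnK // posrE addr_gt0.
by rewrite -expRD ler_expR -lerBlDr; apply: hN => //; exact: ltnW.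
Qed.

Lemma sqrt_natrS n : Num.sqrt n.+1%:R <= Num.sqrt n%:R + 1 :> K.
Proof.
have s0 := sqrtr_ge0 (n%:R : K).
rewrite -(@ler_pXn2r _ 2) ?nnegrE ?sqrtr_ge0 ?addr_ge0 //.
rewrite sqr_sqrtr // sqrrD1 sqr_sqrtr // -natr1 lerD2r lerDl.
by rewrite mulrn_wge0.
Qed.

Lemma sqrt_natr_square n : Num.sqrt (n * n)%:R = n%:R :> K.
Proof. by rewrite natrM -expr2 sqrtr_sqr ger0_norm. Qed.

Lemma slow_phi_mono : exists N : nat, forall m n, (N <= m <= n)%N ->
  phi m%:R <= phi n%:R.
Proof.
have [N [N0 hN]] := exists_nat_gt c; exists N => m n /andP[Nm mn].
have m0 : (0 < m)%N by exact: leq_trans Nm.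
rewrite (slow_phiE m0) (slow_phiE (leq_trans m0 mn)) ler_expR.
apply: sqrt_div_slow_mono; rewrite ler_nat mn andbT.
by apply: le_trans (ltW hN) _; rewrite ler_nat.
Qed.

Lemma slow_phi_unbounded M : exists N : nat, forall n, (N <= n)%N -> M <= phi n%:R.
Proof.
have [C C0 hC] := slow_pow4_le c0 (fun x cx => Rpos0 (lt_le_trans c0 cx)) R4.
have M4 : 0 <= `|M| ^+ 4 by rewrite exprn_ge0.
have [N [N0 hN]] := exists_nat_gt (c + `|M| ^+ 4 * C).
exists N => n Nn; have n0 : (0 < n)%N by exact: leq_trans Nn.
have Nr : N%:R <= n%:R :> K by rewrite ler_nat.
have MC0 : 0 <= `|M| ^+ 4 * C by rewrite mulr_ge0 // ltW.
have c_gt0 := c0.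
have cn : c <= n%:R by lra.
have nC : `|M| ^+ 4 * C <= n%:R by lra.
have nr : 0 < n%:R :> K by rewrite ltr0n.
rewrite slow_phiE //; apply: le_trans (expR_ge1Dx _).
have := ler_norm M; suff : `|M| <= h n%:R by lra.
have Rn := Rpos0 nr.
rewrite ler_pdivlMr // -(@ler_pXn2r _ 4) ?nnegrE ?mulr_ge0 ?sqrtr_ge0 ?(ltW Rn) //.
rewrite exprMn sqrt_pow4 ?(ltW nr) //.
apply: le_trans (ler_wpM2l M4 (hC _ cn)) _.
by rewrite mulrA expr2 ler_wpM2r // ltW.
Qed.

End slow_growth.

(** * Mass bounds for sparse large digits *)

Section sparse_large_digits.
Context {K : realType}.
Implicit Types (e M : K).
Context (k0 M : nat) (F : nat -> nat) (sg lam : K).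
Context (k0_ge2 : (2 <= k0)%N) (M0 : (0 < M)%N) (F0 : forall i, (0 < F i)%N)
  (sg0 : 0 < sg) (sg1 : sg < 1) (lam1 : 1 < lam)
  (lamM : lam <= (1 - 2 / (M%:R + 1)) * 2 `^ (1 - sg))
  (cost : forall k, (k0 <= k)%N ->
     6 ^+ 3 * (F (k.+1 * k.+1))%:R ^+ 2 <= lam ^+ (2 * k - 2)).

Local Notation sq := (square_from k0).

(* Position [n] carries the partial quotient number [n.+1]: those numbered
   k^2 with k0 <= k are large, their two neighbours are 1. *)
Definition sparse_hi n : nat :=
  if sq n.+1 then F n.+1 else if sq n || sq n.+2 then 1%N else M.

Definition sparse_lo n : nat := if sq n.+1 then F n.+1 else 1%N.

(** An upper bound for the ratio of the parent's [cyl_length] to the power [sg] and the sum of the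
    same powers over its children: forced digits cost, free digits gain [lam]. *)
Definition sparse_cost n : K :=
  if sq n.+1 then (6 * (F n.+1)%:R ^+ 2) `^ sg
  else if sq n || sq n.+2 then 6 `^ sg else lam^-1.

Definition sparse_mass n : K := \prod_(i < n) sparse_cost i.

(** A free position is not followed by a large digit, so the next digit is at most M: the second
    alternative of the gap condition. *)
Definition sparse_free n := ~~ (sq n || sq n.+1 || sq n.+2).

Lemma lam_gt0 : 0 < lam. Proof. exact: lt_trans ltr01 lam1. Qed.

Lemma sparse_cost_gt0 n : 0 < sparse_cost n.
Proof.
rewrite /sparse_cost; case: ifP => _.
  by rewrite powR_gt0 // mulr_gt0 // exprn_gt0 // ltr0n.
by case: ifP => _; rewrite ?invr_gt0 ?lam_gt0 ?powR_gt0.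
Qed.

Lemma sparse_mass_gt0 n : 0 < sparse_mass n.
Proof. by apply: prodr_gt0 => i _; exact: sparse_cost_gt0. Qed.

Lemma sparse_massS n : sparse_mass n.+1 = sparse_mass n * sparse_cost n.
Proof. exact: big_ord_recr. Qed.

Lemma sparse_mass_run m j : (forall i, (i < j)%N -> sparse_free (m + i)) ->
  sparse_mass (m + j) = sparse_mass m * lam ^- j.
Proof.
elim: j => [|j IH] free; first by rewrite addn0 expr0 invr1 mulr1.
rewrite addnS sparse_massS IH => [|i ij]; last by apply: free; exact: leqW.
have := free j (ltnSn j); rewrite /sparse_free !negb_or /sparse_cost.
by move=> /andP[/andP[/negPf-> /negPf->] /negPf->] /=; rewrite exprS invfM mulrA mulrAC.
Qed.

Lemma sparse_free_between k i : (k0 <= k)%N -> (i < 2 * k - 2)%N ->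
  sparse_free ((k * k).+1 + i).
Proof.
move=> kk ik; rewrite /sparse_free !negb_or.
by rewrite !(@square_from_gap k0 k) //; apply/andP; split; nia.
Qed.

Lemma powR_le_self (x : K) : 1 <= x -> x `^ sg <= x.
Proof.
move=> x1; rewrite -[leRHS]powRr1 ?(le_trans _ x1) //.
by apply: ler_powR => //; exact: ltW.
Qed.

(** A block consists of 2 k - 2 free positions, then a 1, the large digit at (k + 1)^2, and a 1. By
    [cost], the gain on the free positions covers the three forced digits. *)
Lemma sparse_mass_block k : (k0 <= k)%N ->
  sparse_mass (k.+1 * k.+1).+1 <= sparse_mass (k * k).+1.
Proof.
move=> kk; have [n nE] : exists n, n = ((k * k).+1 + (2 * k - 2))%N by eexists.
have E : (k.+1 * k.+1).+1 = n.+3 by nia.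
have sq2 : sq n.+2.
  by apply/square_fromP; exists k.+1; [exact: leqW | nia].
have sq1 : sq n.+1 = false.
  by apply/negbTE/(@square_from_gap k0 k); apply/andP; split; nia.
have sq3 : sq n.+3 = false.
  by apply/negbTE/(@square_from_gap k0 k.+1); apply/andP; split; nia.
rewrite E 3!sparse_massS.
have -> : sparse_cost n = 6 `^ sg by rewrite /sparse_cost sq1 sq2 orbT.
have -> : sparse_cost n.+2 = 6 `^ sg by rewrite /sparse_cost sq3 sq2.
have -> : sparse_cost n.+1 = (6 * (F n.+2)%:R ^+ 2) `^ sg by rewrite /sparse_cost sq2.
have -> : sparse_mass n = sparse_mass (k * k).+1 * lam ^- (2 * k - 2).
  by rewrite nE; apply: sparse_mass_run => i; exact: (sparse_free_between kk).
have Fn : n.+2 = (k.+1 * k.+1)%N by nia.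
have F1 : 1 <= (F n.+2)%:R ^+ 2 :> K by rewrite exprn_ege1 // ler1n.
have c1 : 6 `^ sg <= 6 :> K by apply: powR_le_self; lra.
have c2 : (6 * (F n.+2)%:R ^+ 2) `^ sg <= 6 * (F n.+2)%:R ^+ 2 by apply: powR_le_self; lra.
have L0 : 0 < lam ^+ (2 * k - 2) by rewrite exprn_gt0 // lam_gt0.
have h : 6 `^ sg * (6 * (F n.+2)%:R ^+ 2) `^ sg * 6 `^ sg <= lam ^+ (2 * k - 2).
  apply: le_trans (cost kk); rewrite -Fn.
  have -> : 6 ^+ 3 * (F n.+2)%:R ^+ 2 = 6 * (6 * (F n.+2)%:R ^+ 2) * 6 :> K by ring.
  by rewrite !ler_pM ?mulr_ge0 ?powR_ge0.
rewrite -!mulrA -[leRHS]mulr1 ler_wpM2l ?(ltW (sparse_mass_gt0 _)) //.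
by rewrite ler_pdivrMl // mulr1 mulrA.
Qed.

Lemma sparse_mass_after k : (k0 <= k)%N ->
  sparse_mass (k * k).+1 <= sparse_mass (k0 * k0).+1.
Proof.
elim: k => [|k IH]; first by rewrite leqn0 => /eqP ->.
rewrite leq_eqVlt => /predU1P[<- //|kk].
exact: le_trans (sparse_mass_block kk) (IH kk).
Qed.

Lemma lamV_exp_le1 j : lam ^- j <= 1.
Proof. by rewrite invf_le1 ?exprn_gt0 ?lam_gt0 // exprn_ege1 // ltW. Qed.

(** The mass bound jumps at a large digit, so it is controlled only at free positions: it is at most
    1 before the first block, and later it decreases along each free run and from block to block. *)
Lemma sparse_mass_bound n : sparse_free n ->
  sparse_mass n <= 1 + sparse_mass (k0 * k0).+1.
Proof.
rewrite /sparse_free !negb_or => /andP[/andP[n0 n1] n2].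
have B0 := sparse_mass_gt0 (k0 * k0).+1.
have [nk|kn] := ltnP n (k0 * k0).
  have nk2 : (n.+2 < k0 * k0)%N.
    have e1 : n.+1 != (k0 * k0)%N by apply: contraNneq n1 => e; apply/square_fromP; exists k0.
    have e2 : n.+2 != (k0 * k0)%N by apply: contraNneq n2 => e; apply/square_fromP; exists k0.
    by move: nk e1 e2; clear; lia.
  rewrite -[n]add0n sparse_mass_run => [|i ij].
    by rewrite /sparse_mass big_ord0 mul1r (le_trans (lamV_exp_le1 n)) // lerDl ltW.
  rewrite add0n; have ik : (i.+2 < k0 * k0)%N by apply: leq_ltn_trans nk2; rewrite !ltnS ltnW.
  by rewrite /sparse_free !negb_or !square_from_lt // ltnW // ltnW.
have [k /andP[kn1 nk1]] := nat_sqrt_exists n.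
have kk : (k0 <= k)%N by rewrite leqNgt; apply/negP => kk; move: kn nk1 kk; clear; nia.
have e0 : n != (k * k)%N by apply: contraNneq n0 => e; apply/square_fromP; exists k.
have e1 : n.+1 != (k.+1 * k.+1)%N.
  by apply: contraNneq n1 => e; apply/square_fromP; exists k.+1; rewrite ?leqW.
have e2 : n.+2 != (k.+1 * k.+1)%N.
  by apply: contraNneq n2 => e; apply/square_fromP; exists k.+1; rewrite ?leqW.
have -> : n = ((k * k).+1 + (n - (k * k).+1))%N.
  by move: kn1 e0; clear; lia.
rewrite sparse_mass_run => [|i ij]; last first.
  by apply: sparse_free_between => //; move: ij nk1 e1 e2; clear; nia.
apply: (@le_trans _ _ (sparse_mass (k * k).+1)).
  by rewrite -[leRHS]mulr1 ler_wpM2l ?lamV_exp_le1 // ltW // sparse_mass_gt0.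
by apply: le_trans (sparse_mass_after kk) _; rewrite lerDr.
Qed.

Lemma sparse_branch n : (sparse_lo n < sparse_hi n)%N -> sparse_free n.
Proof.
rewrite /sparse_lo /sparse_hi /sparse_free; case: (sq n.+1); first by rewrite ltnn.
by rewrite orbF; case: ifP => //; rewrite ltnn.
Qed.

Lemma hausdorff_measure_sparse_neq0 (s : K) (A : set K) : 0 <= s <= sg -> (1 < M)%N ->
  (forall b x, cf_expansion b x ->
     (forall n, (sparse_lo n <= b n <= sparse_hi n)%N) -> A x) ->
  hausdorff_measure s A <> 0%E.
Proof.
move=> s01 M1 HA.
have free_hi n : sparse_free n -> sparse_hi n = M.
  rewrite /sparse_free !negb_or /sparse_hi => /andP[/andP[/negPf-> /negPf->] /negPf->] //.
have free_lo n : sparse_free n -> sparse_lo n = 1%N.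
  by rewrite /sparse_free !negb_or /sparse_lo => /andP[/andP[_ /negPf->] _].
apply: (@hausdorff_measure_digits_neq0 K sg
  ((1 + sparse_mass (k0 * k0).+1) * (M.+1%:R ^+ 2) `^ sg) s M
  sparse_lo sparse_hi sparse_mass) => //.
- move=> n; rewrite /sparse_lo /sparse_hi; case: ifP => _; first by rewrite F0 leqnn.
  by case: ifP.
- by rewrite /sparse_mass big_ord0.
- exact: sparse_mass_gt0.
- move=> w wp; set n := size w; rewrite sparse_massS -mulrA.
  apply: ler_wpM2l; first exact/ltW/sparse_mass_gt0.
  rewrite /sparse_lo /sparse_hi /sparse_cost; case: ifP => _.
    by rewrite big_nat1; apply: cyl_length_pow_ratio => //; exact: ltW.
  case: ifP => _.
    rewrite big_nat1; have -> : 6 = 6 * 1 ^+ 2 :> K by rewrite expr1n mulr1.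
    by apply: cyl_length_pow_ratio => //; exact: ltW.
  rewrite ler_pdivlMl ?lam_gt0 //.
  apply: le_trans (sum_cyl_length_pow M _ wp); last by rewrite sg0.
  by rewrite ler_wpM2r // powR_ge0.
- move=> n /sparse_branch; rewrite /sparse_free !negb_or => /andP[_ /negPf n2].
  by right; rewrite /sparse_hi n2; case: ifP.
- move=> n /sparse_branch fn; rewrite (free_hi n fn).
  by rewrite ler_wpM2r ?powR_ge0 // sparse_mass_bound.
move=> n; pose k := (n + k0)%N; exists (k * k).+1; first by rewrite /k; nia.
have fk : sparse_free (k * k).+1.
  by rewrite -[(k * k).+1]addn0; apply: sparse_free_between; rewrite /k; lia.
by rewrite (free_lo _ fk) (free_hi _ fk).
Qed.

End sparse_large_digits.

(** * Lower bound 1 under slow growth *)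

Section slow_growth_dimension.
Context {K : realType}.
Implicit Types (e : K).
Context (R phi : K -> K) (c : K).
Context (phi0 : forall x, 0 < x -> 0 < phi x)
  (Rpos0 : forall x, 0 < x -> 0 < R x)
  (c0 : 0 < c)
  (Rmono : forall x y, c <= x <= y -> R x <= R y)
  (R4 : forall x y, c <= x <= y -> R y ^+ 4 * x <= R x ^+ 4 * y)
  (Roo : forall M, exists X, forall x, X <= x -> M <= R x)
  (lnphi : forall n : nat, (0 < n)%N -> ln (phi n%:R) = Num.sqrt n%:R / R n%:R).

(** The maximum with 1 makes every value a legal digit, including at i = 0, where phi is
    unconstrained. *)
Definition floor_phi (i : nat) : nat := maxn 1 (Num.truncn (phi i%:R)).

Lemma floor_phi_gt0 i : (0 < floor_phi i)%N.
Proof. exact: leq_maxl. Qed.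

Lemma floor_phi_itv i : (0 < i)%N ->
  phi i%:R - 1 <= (floor_phi i)%:R <= phi i%:R.
Proof.
move=> i0; have p1 := slow_phi_ge1 phi0 Rpos0 lnphi i0.
have p0 : 0 <= phi i%:R by apply: le_trans p1.
have /andP[h1 h2] := truncn_itv p0.
rewrite /floor_phi (maxn_idPr _) ?truncn_gt0 // h1 andbT.
by move: h2; rewrite -natr1; move: (Num.truncn _)%:R => t; lra.
Qed.

Lemma floor_phi_cost (l : K) : 0 < l -> exists N : nat, forall k, (N <= k)%N ->
  6 ^+ 3 * (floor_phi (k.+1 * k.+1))%:R ^+ 2 <= expR l ^+ (2 * k - 2).
Proof.
(* Then 1 / R <= l / 4, so the squared digit contributes at most (k + 1) l / 2 to the exponent; the
   budget (2 k - 2) l leaves at least (k - 3) l, enough for the constant 6^3 <= exp a. *)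
move=> l0; have [X hX] := Roo (4 / l).
have [a a0 ea] : exists2 a : K, 0 < a & 6 ^+ 3 <= expR a.
  exists (6 ^+ 3); first by rewrite exprn_gt0.
  by apply: le_trans (expR_ge1Dx _); rewrite lerDr.
have [N [N0 hN]] := exists_nat_gt (`|X| + (3 + a / l)).
exists N => k Nk; have kr : N%:R <= k%:R :> K by rewrite ler_nat.
have k1 : (1 <= k)%N by exact: leq_trans Nk.
have X1 := ler_norm X; have X0 := normr_ge0 X.
have la0 : 0 < a / l by rewrite divr_gt0.
have kl : 3 + a / l <= k%:R.
  by apply: le_trans kr; apply: le_trans (ltW hN); rewrite lerDr.
have kX : X <= k%:R.
  apply: le_trans X1 _; apply: le_trans kr; apply: le_trans (ltW hN).
  by rewrite lerDl addr_ge0 // ltW.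
have [n nE] : exists n, n = (k.+1 * k.+1)%N by eexists.
rewrite -nE; have n0 : (0 < n)%N by rewrite nE.
have kn : k%:R <= n%:R :> K.
  by rewrite ler_nat nE (leq_trans (leqnSn k)) // leq_pmulr.
have Rn : 4 / l <= R n%:R by apply: hX; exact: le_trans kn.
have /andP[_ Fn] := floor_phi_itv n0.
have F0 : 0 <= (floor_phi n)%:R :> K by exact: ler0n.
apply: (@le_trans _ _ (6 ^+ 3 * phi n%:R ^+ 2)).
  by rewrite ler_wpM2l // lerXn2r ?nnegrE // (le_trans F0).
rewrite (slow_phiE phi0 lnphi n0).
have -> : Num.sqrt n%:R = k.+1%:R :> K by rewrite nE sqrt_natr_square.
apply: (@le_trans _ _ (expR a * expR (k.+1%:R / R n%:R) ^+ 2)).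
  by rewrite ler_wpM2r // exprn_ge0 // expR_ge0.
rewrite -!expRM_natl -expRD ler_expR natrB ?natrM; last by rewrite -[X in (X <= _)%N]muln1 leq_mul2l.
have Rn0 : 0 < R n%:R by apply: lt_le_trans Rn; rewrite divr_gt0.
have RV : (R n%:R)^-1 <= l / 4.
  by rewrite -[l / 4]invrK lef_pV2 ?posrE ?invr_gt0 ?divr_gt0 // invf_div.
have k0 : 0 <= k.+1%:R :> K by exact: ler0n.
have h1 := ler_wpM2l k0 RV.
have h2 : a <= (k%:R - 3) * l.
  by rewrite -ler_pdivrMr // lerBrDl.
rewrite -natr1 in h1 *; move: ((k%:R + 1) / R n%:R) h1 => r h1.
have k1r : 1 <= k%:R :> K by rewrite ler1n.
by move: (k%:R : K) h1 h2 k1r => x h1 h2 x1; nra.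
Qed.

Lemma sparse_digits_L_set (k0 M : nat) (b : nat -> nat) (x : K) :
  (2 <= k0)%N -> cf_expansion b x ->
  (forall n, (sparse_lo k0 floor_phi n <= b n <= sparse_hi k0 M floor_phi n)%N) ->
  L_set phi x.
Proof.
move=> k02 bx bd; have [bp _] := bx.
have [N1 h1] := slow_phi_mono phi0 Rpos0 c0 R4 lnphi.
have phioo := slow_phi_unbounded phi0 Rpos0 c0 R4 lnphi.
have digit_sq n : square_from k0 n.+1 -> b n = floor_phi n.+1.
  move=> sqn; have := bd n; rewrite /sparse_lo /sparse_hi sqn => /andP[? ?].
  by apply/eqP; rewrite eqn_leq; apply/andP.
have digit_1 n : ~~ square_from k0 n.+1 -> square_from k0 n || square_from k0 n.+2 ->
    b n = 1%N.
  move=> /negPf n1 n2; have := bd n; rewrite /sparse_lo /sparse_hi n1 n2 => /andP[? ?].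
  by apply/eqP; rewrite eqn_leq; apply/andP.
have digit_M n : ~~ square_from k0 n.+1 -> (b n <= maxn 1 M)%N.
  move=> /negPf n1; have /andP[_] := bd n; rewrite /sparse_hi n1.
  by case: ifP => _ h; apply: leq_trans h _; [exact: leq_maxl | exact: leq_maxr].
have sq_next n : square_from k0 n -> ~~ square_from k0 n.+1.
  move=> /square_fromP[k kk ->]; apply: (@square_from_gap k0 k); apply/andP; split; nia.
apply: (@L_set_of_digits K phi b x N1) => //.
- move=> e e0.
  have [N2 h2] := slow_phi_ratio phi0 Rpos0 c0 Rmono Roo lnphi e0.
  have [N3 h3] := phioo (maxn 1 M * maxn 1 M)%:R.
  exists (N2 + N3).+1 => -[|n] // nn /=.
  have N2n : (N2 <= n.+1)%N by lia.
  have N3n : (N3 <= n.+1)%N by lia.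
  have p0 : 0 <= phi n.+1%:R by apply/ltW/phi0; rewrite ltr0n.
  have pe : phi n.+1%:R <= (1 + e) * phi n.+1%:R by rewrite ler_peMl // lerDl ltW.
  have [s1|s1] := boolP (square_from k0 n.+1).
    rewrite (digit_sq n s1) (digit_1 n.+1) ?sq_next ?s1 // muln1.
    by apply: le_trans pe; have /andP[] := floor_phi_itv (ltn0Sn n).
  (* Here the product is governed by phi (n + 2) but compared with phi (n + 1), so the ratio bound
     is used. *)
  have [s2|s2] := boolP (square_from k0 n.+2).
    rewrite (digit_sq n.+1 s2) (digit_1 n) ?s2 ?orbT // mul1n.
    have /andP[_ /le_trans] := floor_phi_itv (ltn0Sn n.+1); apply.
    by apply: h2 => //; exact: sqrt_natrS.
  apply: le_trans pe; apply: le_trans (h3 _ N3n).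
  by rewrite ler_nat leq_mul // digit_M.
(* One d pays for replacing phi n by phi (k^2), the other for rounding down: (1 - e) (1 + d) <= 1 -
   d, and 1 <= d * phi (k^2). *)
move=> e e0; pose d := Num.min 1 (e / 2).
have d0 : 0 < d by rewrite lt_min ltr01 divr_gt0.
have d1 : d <= 1 by rewrite ge_min lexx.
have de : 2 * d <= e by rewrite mulrC -ler_pdivlMr // ge_min lexx orbT.
have [N2 h2] := slow_phi_ratio phi0 Rpos0 c0 Rmono Roo lnphi d0.
have [N3 h3] := phioo d^-1.
pose N := (N1 + N2 + N3 + k0)%N.
exists (N * N)%N => n nn.
have [k /andP[kn nk]] := nat_sqrt_exists n.
have Nk : (N <= k)%N by rewrite leqNgt; apply/negP => kN; nia.
have [N2k N3k k0k] : [/\ (N2 <= k)%N, (N3 <= k)%N & (k0 <= k)%N].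
  by move: Nk; rewrite /N; clear; split; lia.
have k1 : (1 <= k)%N by exact: leq_trans (ltnW k02) k0k.
have kk0 : (0 < k * k)%N by rewrite muln_gt0 k1.
have kkk : (k <= k * k)%N by rewrite leq_pmulr.
exists (k * k)%N; first by rewrite kk0.
case E : (k * k)%N => [|m]; first by rewrite E in kk0.
rewrite [m.+1.-1]/= digit_sq; last first.
  by rewrite -E; apply/square_fromP; exists k.
rewrite -E natrM.
have b1 : 1 <= (b (k * k)%N)%:R :> K := natr_ge1 (bp _).
have /andP[F1 _] := floor_phi_itv kk0.
have p1 := slow_phi_ge1 phi0 Rpos0 lnphi kk0.
have pd : d^-1 <= phi (k * k)%:R by apply: h3; exact: leq_trans kkk.
have pd1 : 1 <= d * phi (k * k)%:R by rewrite -ler_pdivrMl // mulr1.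
have r1 : phi n%:R <= (1 + d) * phi (k * k)%:R.
  apply: (h2 _ _ (leq_trans N2k kkk) kn); rewrite sqrt_natr_square.
  apply: (@le_trans _ _ (Num.sqrt (k.+1 * k.+1)%:R)).
    by rewrite ler_sqrt // ler_nat ltnW.
  by rewrite sqrt_natr_square natr1.
have F0 : 0 <= (floor_phi (k * k))%:R :> K by exact: ler0n.
apply: (@le_trans _ _ (floor_phi (k * k))%:R); last by rewrite ler_peMr.
have n0 : (0 < n)%N by exact: leq_trans kn.
have pn0 : 0 <= phi n%:R by apply/ltW/phi0; rewrite ltr0n.
have [e1|e1] := leP 1 e; first by apply: le_trans F0; rewrite mulr_le0_ge0 // subr_le0.
apply: le_trans F1.
move: (phi n%:R) (phi (k * k)%:R) pn0 p1 pd1 r1 => p q pn0 p1 pd1 r1.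
have e1' : 0 <= 1 - e by lra.
apply: le_trans (ler_wpM2l e1' r1) _; nra.
Qed.

Lemma L_set_slow_growth_neq0 (s : K) : 0 <= s < 1 ->
  hausdorff_measure s (L_set phi) <> 0%E.
Proof.
move=> /andP[s0 s1]; pose sg : K := (s + 1) / 2.
have [sg0 sg1 ssg] : [/\ 0 < sg, sg < 1 & s <= sg] by rewrite /sg; split; lra.
clearbody sg.
pose g : K := 2 `^ (1 - sg).
have g1 : 1 < g.
  have <- : 1 `^ (1 - sg) = 1 :> K by rewrite powR1.
  by apply: gt0_ltr_powR; rewrite ?nnegrE ?subr_gt0 // ltr1n.
have g0 : 0 < g by exact: lt_trans g1.
have gV : 0 < 1 - g^-1 by rewrite subr_gt0 invf_lt1.
(* This makes 2 / (M + 1) < 1 - 1 / g, which is the condition for lam > 1. *)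
have [M' [M'0 hM']] := exists_nat_gt (2 / (1 - g^-1)).
pose M := M'.+1.
have lam1 : 1 < (1 - 2 / (M%:R + 1)) * g.
  have m0 : 0 < M%:R + 1 :> K by rewrite ltr_wpDl.
  have : 2 / (M%:R + 1) < 1 - g^-1.
    rewrite ltr_pdivrMr // mulrC -ltr_pdivrMr //; apply: lt_trans hM' _.
    by rewrite -natr1; lra.
  move=> h; rewrite -ltr_pdivrMr // mul1r; lra.
set lam := (1 - 2 / (M%:R + 1)) * g in lam1.
have [N hN] := floor_phi_cost (ln_gt0 lam1).
have cost k : (N.+2 <= k)%N ->
    6 ^+ 3 * (floor_phi (k.+1 * k.+1))%:R ^+ 2 <= lam ^+ (2 * k - 2).
  move=> Nk; have := hN k (ltnW (ltnW Nk)).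
  by rewrite lnK // posrE (lt_trans ltr01).
apply: (@hausdorff_measure_sparse_neq0 K N.+2 M floor_phi sg lam) => //.
- exact: floor_phi_gt0.
- by rewrite s0 ssg.
by move=> b x bx bd; apply: (@sparse_digits_L_set N.+2 M b).
Qed.

End slow_growth_dimension.

Theorem theorem1p4 (K : realType) (R phi : K -> K)
    (R_pos : forall x : K, 0 < x -> 0 < R x)
    (R_reg : regularly_increasing R 0%E)
    (phi_pos : forall x : K, 0 < x -> 0 < phi x) :
  ((forall n : nat, (0 < n)%N ->
      ln (phi n%:R) = Num.sqrt n%:R / R n%:R) ->
    hausdorff_dim (L_set phi) = 1%:E) /\
  ((forall n : nat, (0 < n)%N ->
      ln (phi n%:R) = Num.sqrt n%:R * R n%:R) ->
    hausdorff_dim (L_set phi) = (2^-1)%:E).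
Proof.
have [c [c0 Rpos Rmono R4 Roo]] := regularly_increasing_index0 R_reg.
split=> lnphi; apply/eqP; rewrite eq_le; apply/andP; split.
- apply: hausdorff_dim_le => // t t1; apply: hausdorff_measure_gt1 => // x [x01 _ _].
  by case/andP: x01 => /ltW -> ->.
- apply: hausdorff_dim_ge => t t01.
  exact: (@L_set_slow_growth_neq0 K R phi c).
- apply: hausdorff_dim_le => [|t t2]; first by rewrite invr_ge0.
  apply: hausdorff_measure_large_products => //.
  exact: (@L_set_large_digit_products K R phi c).
- apply: hausdorff_dim_ge => t t01.
  exact: (@L_set_fast_growth_neq0 K R phi c).
Qed.
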